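(* ($\mathbf{ZF}$) (i) $\mathbf{IQDI}$ implies that every infinite compact first-countable Hausdorff space contains a copy of $\mathbf{D}(\infty)$ for some infinite discrete cuf space $\mathbf{D}$. (ii) Each of $\mathbf{IDI}$, $\mathbf{WoAm}$ and $\mathbf{BPI}$ implies that every infinite compact first-countable Hausdorff space contains a copy of $\mathbb{N}(\infty)$. (iii) Every infinite first-countable compact Hausdorff separable space contains a copy of $\mathbb{N}(\infty)$. Every infinite first-countable compact Hausdorff space having an infinite cuf subset contains a copy of $\mathbf{D}(\infty)$ for some infinite discrete cuf space $\mathbf{D}$.
   Context: The theorem is in $\mathbf{ZF}$ (no axiom of choice). ''Contains a copy of $\mathbf{K}$'' means has a subspace homeomorphic to $\mathbf{K}$. For a non-compact locally compact Hausdorff space $\mathbf{X}$, $\mathbf{X}(\infty)$ is its Alexandroff (one-point) compactification; $\mathbb{N}$ carries the discrete topology in $\mathbb{N}(\infty)$. A cuf set is a countable union of finite sets; a cuf space is a space whose underlying set is a cuf set. First-countable: every point has a countable base of open neighborhoods. Compact: every open cover has a finite subcover. A set is Dedekind-infinite if $\omega$ injects into it. A set $X$ is quasi Dedekind-infinite if the set $[X]^{<\omega}$ of all its finite subsets is Dedekind-infinite. A set is amorphous if it is infinite and every infinite subset of it has finite complement in it. Principles: - $\mathbf{IQDI}$: every infinite set is quasi Dedekind-infinite. - $\mathbf{IDI}$: every infinite set is Dedekind-infinite. - $\mathbf{WoAm}$: every infinite set is either well-orderable or has an amorphous subset. - $\mathbf{BPI}$: every Boolean algebra has a prime ideal. 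*)

(* Defs.v *)
(** The theorem is about what [ZF] proves without the axiom of choice.  The
    ambient logic of Rocq is not a substitute for [ZF]: choice is a usual axiom
    there, and it would make all the choice principles below hold.  Hence the
    theorem is stated inside an arbitrary model [(V, ∈)] of first-order [ZF]; by
    Goedel's completeness theorem, truth in all these models is provability in
    [ZF].

    - Separation and replacement range over first-order formulas with
      parameters, never over arbitrary predicates [V -> Prop], since those
      could import choice from the ambient logic.
    - Every mathematical notion is the relativization to [V] of its usual
      set-theoretic definition: all quantifiers range over [V], and functions,
      families, natural numbers, topologies are elements of [V].
    - Set operations are given by their graphs: [is_union u a] is "u = ⋃ a". *)

Record structure : Type := Structure {
  carrier :> Type;
  mem : carrier -> carrier -> Prop
}.

Arguments mem {_} _ _.

Notation "x ∈ y" := (mem x y) (at level 70, no associativity).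
Notation "x ∉ y" := (~ mem x y) (at level 70, no associativity).

(** * First-order ZF *)

(** Formulas of the language [{∈, =}], with de Bruijn indices. *)
Inductive formula : Type :=
| fMem : nat -> nat -> formula
| fEq : nat -> nat -> formula
| fFalse : formula
| fImp : formula -> formula -> formula
| fAnd : formula -> formula -> formula
| fOr : formula -> formula -> formula
| fAll : formula -> formula
| fEx : formula -> formula.

Definition scons {T : Type} (x : T) (e : nat -> T) (n : nat) : T :=
  match n with
  | O => x
  | S m => e m
  end.

Fixpoint sat {V : structure} (e : nat -> V) (phi : formula) : Prop :=
  match phi with
  | fMem i j => e i ∈ e j
  | fEq i j => e i = e j
  | fFalse => False
  | fImp p q => sat e p -> sat e q
  | fAnd p q => sat e p /\ sat e q
  | fOr p q => sat e p \/ sat e q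
  | fAll p => forall x : V, sat (scons x e) p
  | fEx p => exists x : V, sat (scons x e) p
  end.

Section SetOperations.
Context {V : structure}.
Implicit Types a b p u x y z : V.

Definition subset a b : Prop := forall x, x ∈ a -> x ∈ b.

Definition is_empty a : Prop := forall x, x ∉ a.

Definition is_upair p a b : Prop := forall x, x ∈ p <-> x = a \/ x = b.

Definition is_union u a : Prop := forall x, x ∈ u <-> exists y, y ∈ a /\ x ∈ y.

Definition is_powerset p a : Prop := forall x, x ∈ p <-> subset x a.

Definition is_inter u a b : Prop := forall x, x ∈ u <-> x ∈ a /\ x ∈ b.

Definition is_diff u a b : Prop := forall x, x ∈ u <-> x ∈ a /\ x ∉ b.

Definition is_succ y x : Prop := forall z, z ∈ y <-> z ∈ x \/ z = x.

Definition inductive_set a : Prop :=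
  (exists x, is_empty x /\ x ∈ a) /\
  (forall x, x ∈ a -> exists y, is_succ y x /\ y ∈ a).

End SetOperations.

Record ZF (V : structure) : Prop := {
  zf_extensionality : forall a b : V, (forall x, x ∈ a <-> x ∈ b) -> a = b;
  zf_foundation : forall a : V, (exists x, x ∈ a) ->
    exists x, x ∈ a /\ forall y, y ∈ x -> y ∉ a;
  zf_pairing : forall a b : V, exists p, is_upair p a b;
  zf_union : forall a : V, exists u, is_union u a;
  zf_powerset : forall a : V, exists p, is_powerset p a;
  zf_infinity : exists a : V, inductive_set a;
  zf_separation : forall (phi : formula) (e : nat -> V) (a : V),
    exists b, forall x, x ∈ b <-> x ∈ a /\ sat (scons x e) phi;
  zf_replacement : forall (phi : formula) (e : nat -> V) (a : V),
    (forall x, x ∈ a -> forall y y',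
       sat (scons x (scons y e)) phi -> sat (scons x (scons y' e)) phi ->
       y = y') ->
    exists b, forall y,
      y ∈ b <-> exists x, x ∈ a /\ sat (scons x (scons y e)) phi
}.

(** * Functions and cardinality *)

Section Cardinality.
Context {V : structure}.
Implicit Types a b f n p w x y A F R X Y : V.

(** Kuratowski pairs: [p = {{a}, {a, b}}]. *)
Definition is_opair p a b : Prop :=
  exists x y, is_upair x a a /\ is_upair y a b /\ is_upair p x y.

(** "(a, b) ∈ R"; also "f(a) = b" for a function. *)
Definition rel R a b : Prop := exists p, is_opair p a b /\ p ∈ R.

Definition is_function f X Y : Prop :=
  (forall p, p ∈ f -> exists a b, a ∈ X /\ b ∈ Y /\ is_opair p a b) /\
  (forall a, a ∈ X -> exists! b, rel f a b).

Definition is_injection f X Y : Prop :=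
  is_function f X Y /\
  (forall a a' b, rel f a b -> rel f a' b -> a = a').

Definition is_bijection f X Y : Prop :=
  is_injection f X Y /\ (forall b, b ∈ Y -> exists a, rel f a b).

Definition is_omega w : Prop :=
  inductive_set w /\ forall a, inductive_set a -> subset w a.

Definition finite X : Prop :=
  exists w n f, is_omega w /\ n ∈ w /\ is_bijection f n X.

Definition infinite X : Prop := ~ finite X.

(** Finite sets count as countable. *)
Definition countable X : Prop :=
  exists w f, is_omega w /\ is_injection f X w.

Definition cuf X : Prop :=
  exists A, countable A /\ (forall F, F ∈ A -> finite F) /\ is_union X A.

Definition dedekind_infinite X : Prop :=
  exists w f, is_omega w /\ is_injection f w X.

Definition is_finite_subsets F X : Prop :=
  forall a, a ∈ F <-> subset a X /\ finite a.

Definition quasi_dedekind_infinite X : Prop :=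
  exists F, is_finite_subsets F X /\ dedekind_infinite F.

Definition amorphous X : Prop :=
  infinite X /\
  (forall Y, subset Y X -> infinite Y -> exists F, is_diff F X Y /\ finite F).

(** [R] restricted to [X] is a strict well-order. *)
Definition well_orders R X : Prop :=
  (forall x, x ∈ X -> ~ rel R x x) /\
  (forall x y z, x ∈ X -> y ∈ X -> z ∈ X -> rel R x y -> rel R y z -> rel R x z) /\
  (forall x y, x ∈ X -> y ∈ X -> rel R x y \/ x = y \/ rel R y x) /\
  (forall Y, subset Y X -> (exists y, y ∈ Y) ->
     exists m, m ∈ Y /\ forall y, y ∈ Y -> m = y \/ rel R m y).

Definition well_orderable X : Prop := exists R, well_orders R X.

End Cardinality.

(** * Boolean algebras *)

Section BooleanAlgebras.
Context {V : structure}.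
Implicit Types a b c d u v B I R : V.

Definition partial_order B R : Prop :=
  (forall a, a ∈ B -> rel R a a) /\
  (forall a b, a ∈ B -> b ∈ B -> rel R a b -> rel R b a -> a = b) /\
  (forall a b c, a ∈ B -> b ∈ B -> c ∈ B -> rel R a b -> rel R b c -> rel R a c).

Definition is_join B R a b c : Prop :=
  c ∈ B /\ rel R a c /\ rel R b c /\
  (forall d, d ∈ B -> rel R a d -> rel R b d -> rel R c d).

Definition is_meet B R a b c : Prop :=
  c ∈ B /\ rel R c a /\ rel R c b /\
  (forall d, d ∈ B -> rel R d a -> rel R d b -> rel R d c).

Definition is_bottom B R a : Prop := a ∈ B /\ forall b, b ∈ B -> rel R a b.

Definition is_top B R a : Prop := a ∈ B /\ forall b, b ∈ B -> rel R b a.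

(** A complemented distributive lattice.  It is required to be nondegenerate
    (0 ≠ 1), since the one-element algebra has no proper ideal. *)
Definition boolean_algebra B R : Prop :=
  partial_order B R /\
  (forall a b, a ∈ B -> b ∈ B -> exists c, is_join B R a b c) /\
  (forall a b, a ∈ B -> b ∈ B -> exists c, is_meet B R a b c) /\
  (forall a b c d u v x, a ∈ B -> b ∈ B -> c ∈ B ->
     is_join B R b c d -> is_meet B R a d x ->
     is_meet B R a b u -> is_meet B R a c v -> is_join B R u v x) /\
  (exists o i, is_bottom B R o /\ is_top B R i /\ o <> i /\
     forall a, a ∈ B -> exists a', a' ∈ B /\ is_join B R a a' i /\ is_meet B R a a' o).

Definition prime_ideal B R I : Prop :=
  subset I B /\
  (forall o, is_bottom B R o -> o ∈ I) /\
  (forall i, is_top B R i -> i ∉ I) /\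
  (forall a b, a ∈ I -> b ∈ B -> rel R b a -> b ∈ I) /\
  (forall a b c, a ∈ I -> b ∈ I -> is_join B R a b c -> c ∈ I) /\
  (forall a b c, a ∈ B -> b ∈ B -> is_meet B R a b c -> c ∈ I -> a ∈ I \/ b ∈ I).

End BooleanAlgebras.

(** * Choice principles *)

Definition IQDI (V : structure) : Prop :=
  forall X : V, infinite X -> quasi_dedekind_infinite X.

Definition IDI (V : structure) : Prop :=
  forall X : V, infinite X -> dedekind_infinite X.

Definition WoAm (V : structure) : Prop :=
  forall X : V, infinite X ->
    well_orderable X \/ exists A, subset A X /\ amorphous A.

Definition BPI (V : structure) : Prop :=
  forall B R : V, boolean_algebra B R -> exists I, prime_ideal B R I.

(** * Topological spaces *)

Section Topology.
Context {V : structure}.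
Implicit Types b f g u x y z A B C D F K O P S T U W X Y Z : V.

Definition topology X T : Prop :=
  (forall U, U ∈ T -> subset U X) /\
  (forall U, is_empty U -> U ∈ T) /\
  X ∈ T /\
  (forall U W O, U ∈ T -> W ∈ T -> is_inter O U W -> O ∈ T) /\
  (forall C O, subset C T -> is_union O C -> O ∈ T).

Definition hausdorff X T : Prop :=
  forall x y, x ∈ X -> y ∈ X -> x <> y ->
    exists U W, U ∈ T /\ W ∈ T /\ x ∈ U /\ y ∈ W /\ ~ (exists z, z ∈ U /\ z ∈ W).

Definition covers C X : Prop :=
  forall x, x ∈ X -> exists U, U ∈ C /\ x ∈ U.

Definition compact X T : Prop :=
  forall C, subset C T -> covers C X ->
    exists F, subset F C /\ finite F /\ covers F X.

Definition first_countable X T : Prop :=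
  forall x, x ∈ X ->
    exists B, countable B /\
      (forall b, b ∈ B -> b ∈ T /\ x ∈ b) /\
      (forall U, U ∈ T -> x ∈ U -> exists b, b ∈ B /\ subset b U).

Definition separable X T : Prop :=
  exists A, subset A X /\ countable A /\
    (forall U, U ∈ T -> (exists x, x ∈ U) -> exists a, a ∈ A /\ a ∈ U).

Definition closed_in X T A : Prop :=
  subset A X /\ exists U, is_diff U X A /\ U ∈ T.

(** [S] is the topology on [A] induced by [T]. *)
Definition is_subspace_topology S A T : Prop :=
  forall U, U ∈ S <-> exists O, O ∈ T /\ is_inter U O A.

Definition compact_subset X T K : Prop :=
  subset K X /\ exists S, is_subspace_topology S K T /\ compact K S.

Definition continuous f X T Y S : Prop :=
  is_function f X Y /\
  (forall W, W ∈ S -> exists U, U ∈ T /\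
     forall x, x ∈ U <-> x ∈ X /\ exists y, y ∈ W /\ rel f x y).

Definition homeomorphic X T Y S : Prop :=
  exists f g, continuous f X T Y S /\ continuous g Y S X T /\
    (forall x y, rel f x y <-> rel g y x).

(** [(X, T)] has a subspace homeomorphic to [(K, S)]. *)
Definition contains_copy X T K S : Prop :=
  exists Z TZ, subset Z X /\ is_subspace_topology TZ Z T /\ homeomorphic Z TZ K S.

(** [(Y, S)] is the one-point compactification of [(X, T)], with a point at
    infinity [u] not in [X]; [u] is not specified further, so [(Y, S)] is unique
    up to homeomorphism only. *)
Definition is_alexandroff Y S X T : Prop :=
  exists u, u ∉ X /\
    (forall y, y ∈ Y <-> y ∈ X \/ y = u) /\
    (forall U, U ∈ S <->
       U ∈ T \/
       (subset U Y /\ u ∈ U /\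
        exists K, is_diff K Y U /\ closed_in X T K /\ compact_subset X T K)).

(** The discrete topology on [D] is its power set. *)
Definition contains_alexandroff_of_discrete X T D : Prop :=
  exists P Y S, is_powerset P D /\ is_alexandroff Y S D P /\ contains_copy X T Y S.

Definition contains_alexandroff_of_infinite_discrete_cuf X T : Prop :=
  exists D, infinite D /\ cuf D /\ contains_alexandroff_of_discrete X T D.

Definition contains_alexandroff_of_N X T : Prop :=
  exists w, is_omega w /\ contains_alexandroff_of_discrete X T w.

End Topology.

(* Main.v *)
(** Separation and replacement in [V] are available for the predicates and
    functions that are definable with parameters; definability is closed under
    the connectives, quantifiers over [V], substitution of definable terms and
    set comprehension, so that it can be checked syntactically.

    Let [X] be compact, Hausdorff and first-countable.  An infinite subset [A] of
    [X] accumulates at some point [x], which has a decreasing countable base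
    [(B n)].  If [A] is the union of finite sets [F_k], take for each [n] the
    first [F_k] that meets [B n] outside [x], and collect the points of these
    [F_k ∩ B n] other than [x] into a set [D].  It is infinite and all but
    finitely many of its points lie in any given [B n], so that [D ∪ {x}] is the
    one-point compactification of the discrete cuf set [D].  If [A] is
    countable, [D] contains a sequence of distinct points and one gets a copy of
    [N(∞)].  This reduces everything to finding an infinite cuf (or countable)
    subset.

    - IQDI: the union of a sequence of distinct finite sets is infinite and cuf.
    - WoAm: an infinite well-orderable set contains a sequence of distinct
      points.  An amorphous subset accumulating at [x] would be mapped
      finite-to-one into the natural numbers by the first [n] with [a ∉ B n],
      and pulling back a splitting of the image in two infinite parts
      contradicts amorphousness.
    - BPI: there is a choice function for the nonempty closed subsets of [X] in a
      given family, since ultrafilters exist and have unique limits in [X].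
      Choosing a point in a nonempty [cl(B n) \ B m], with [m] least, for every
      [n] yields a countable set accumulating at [x]. *)

From Stdlib Require Import Classical ClassicalEpsilon Setoid.
Require Import Defs.

(** * Renaming of variables and definability with parameters *)

Section ZFModel.
Context {V : structure}.

Definition up (r : nat -> nat) (n : nat) : nat :=
  match n with O => O | S m => S (r m) end.

Fixpoint rename (r : nat -> nat) (phi : formula) : formula :=
  match phi with
  | fMem i j => fMem (r i) (r j)
  | fEq i j => fEq (r i) (r j)
  | fFalse => fFalse
  | fImp p q => fImp (rename r p) (rename r q)
  | fAnd p q => fAnd (rename r p) (rename r q)
  | fOr p q => fOr (rename r p) (rename r q)
  | fAll p => fAll (rename (up r) p)
  | fEx p => fEx (rename (up r) p)
  end.

Lemma sat_ext phi : forall e e' : nat -> V,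
  (forall n, e n = e' n) -> (sat e phi <-> sat e' phi).
Proof.
  induction phi as [i j|i j| |p IHp q IHq|p IHp q IHq|p IHp q IHq|p IH|p IH];
    intros e e' H; simpl; rewrite ?H; try tauto.
  1-3: rewrite (IHp _ _ H), (IHq _ _ H); tauto.
  all: assert (E : forall x, sat (scons x e) p <-> sat (scons x e') p)
    by (intro x; apply IH; intros [|n]; simpl; auto).
  - split; intros K x; apply E, K.
  - split; intros [x K]; exists x; apply E, K.
Qed.

Lemma sat_rename phi : forall r (e : nat -> V),
  sat e (rename r phi) <-> sat (fun n => e (r n)) phi.
Proof.
  induction phi as [i j|i j| |p IHp q IHq|p IHp q IHq|p IHp q IHq|p IH|p IH];
    intros r e; simpl; try tauto.
  1-3: rewrite (IHp r e), (IHq r e); tauto.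
  all: assert (E : forall x, sat (scons x e) (rename (up r) p)
                          <-> sat (scons x (fun n => e (r n))) p)
    by (intro x; rewrite IH; apply sat_ext; intros [|n]; reflexivity).
  - split; intros K x; apply E, K.
  - split; intros [x K]; exists x; apply E, K.
Qed.

Definition eval (e : nat -> V) (s : nat + V) : V :=
  match s with inl j => e j | inr c => c end.

(** The free variables of the formula are interpreted by entries of [e] or by
    parameters from [V]. *)
Definition definable (P : (nat -> V) -> Prop) : Prop :=
  exists phi r, forall e, P e <-> sat (fun i => eval e (r i)) phi.

(** The language has no function symbols, so a term is handled through its graph: index 0 holds the
    value, and the variables of the term are shifted by one. *)
Definition dterm (t : (nat -> V) -> V) : Prop :=
  definable (fun e => e 0 = t (fun n => e (S n))).

Definition definable1 (P : V -> Prop) : Prop := definable (fun e => P (e 0)).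
Definition definable2 (P : V -> V -> Prop) : Prop :=
  definable (fun e => P (e 0) (e 1)).
Definition definable3 (P : V -> V -> V -> Prop) : Prop :=
  definable (fun e => P (e 0) (e 1) (e 2)).
(** The value comes first, so that [dfun1 F] is convertible with [dterm (fun e => F (e 0))]. *)
Definition dfun1 (F : V -> V) : Prop := definable2 (fun y x => y = F x).
Definition dfun2 (F : V -> V -> V) : Prop :=
  definable3 (fun z x y => z = F x y).

Lemma definable_ext (P Q : (nat -> V) -> Prop) :
  (forall e, P e <-> Q e) -> definable P -> definable Q.
Proof.
  intros H (phi & r & K). exists phi, r. intro e. rewrite <- H. apply K.
Qed.

Lemma definable_mem_var i j : definable (fun e => e i ∈ e j).
Proof.
  exists (fMem i j), inl. intro e; simpl; tauto.
Qed.

Lemma definable_eq_var i j : definable (fun e => e i = e j).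
Proof.
  exists (fEq i j), inl. intro e; simpl; tauto.
Qed.

Lemma definable_False : definable (fun _ => False).
Proof.
  exists fFalse, inl. intro e; simpl; tauto.
Qed.

Lemma dterm_var i : dterm (fun e => e i).
Proof. exact (definable_eq_var 0 (S i)). Qed.

Lemma dterm_const (c : V) : dterm (fun _ => c).
Proof.
  exists (fEq 0 1), (fun i => match i with O => inl 0 | _ => inr c end).
  intro e; simpl; tauto.
Qed.

(** Decodes parity: [inl k] for the even number 2k, [inr k] for the odd number 2k+1. *)
Fixpoint halve (n : nat) : nat + nat :=
  match n with
  | O => inl O
  | S m => match halve m with inl k => inr k | inr k => inl (S k) end
  end.

Lemma halve_spec n : halve (n + n) = inl n /\ halve (S (n + n)) = inr n.
Proof.
  assert (H : halve (n + n) = inl n).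
  { induction n as [|n IH]; [reflexivity|].
    rewrite <- plus_n_Sm; simpl; rewrite IH; reflexivity. }
  split; [exact H|]. simpl; rewrite H; reflexivity.
Qed.

(** Two definitions come with unrelated interpretations of their free variables. Moving the
    variables of one formula to even indices and those of the other to odd indices lets a single
    interpretation serve both, as the binary connectives require. *)
Lemma common_parameters (P Q : (nat -> V) -> Prop) :
  definable P -> definable Q -> exists phi psi r,
    (forall e, P e <-> sat (fun i => eval e (r i)) phi) /\
    (forall e, Q e <-> sat (fun i => eval e (r i)) psi).
Proof.
  intros (phi & r & H) (psi & s & K).
  exists (rename (fun n => n + n) phi), (rename (fun n => S (n + n)) psi),
    (fun i => match halve i with inl k => r k | inr k => s k end).
  split; intro e.
  - rewrite H, sat_rename. apply sat_ext. intro n.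
    rewrite (proj1 (halve_spec n)); reflexivity.
  - rewrite K, sat_rename. apply sat_ext. intro n.
    rewrite (proj2 (halve_spec n)); reflexivity.
Qed.

Lemma definable_and (P Q : (nat -> V) -> Prop) :
  definable P -> definable Q -> definable (fun e => P e /\ Q e).
Proof.
  intros HP HQ. destruct (common_parameters P Q HP HQ) as (phi & psi & r & H & K).
  exists (fAnd phi psi), r. intro e; simpl. rewrite H, K; tauto.
Qed.

Lemma definable_or (P Q : (nat -> V) -> Prop) :
  definable P -> definable Q -> definable (fun e => P e \/ Q e).
Proof.
  intros HP HQ. destruct (common_parameters P Q HP HQ) as (phi & psi & r & H & K).
  exists (fOr phi psi), r. intro e; simpl. rewrite H, K; tauto.
Qed.

Lemma definable_imp (P Q : (nat -> V) -> Prop) :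
  definable P -> definable Q -> definable (fun e => P e -> Q e).
Proof.
  intros HP HQ. destruct (common_parameters P Q HP HQ) as (phi & psi & r & H & K).
  exists (fImp phi psi), r. intro e; simpl. rewrite H, K; tauto.
Qed.

Lemma definable_not (P : (nat -> V) -> Prop) :
  definable P -> definable (fun e => ~ P e).
Proof. intro H. apply definable_imp; [exact H|exact definable_False]. Qed.

Lemma definable_iff (P Q : (nat -> V) -> Prop) :
  definable P -> definable Q -> definable (fun e => P e <-> Q e).
Proof. intros H K. apply definable_and; apply definable_imp; assumption. Qed.

(** Several variables of the formula may be interpreted by entry 0 of the environment. All of them
    are merged into the de Bruijn index 0, ready to be quantified, and the others are shifted up
    with their interpretation unchanged. *)
Lemma bind_variable (Q : V -> (nat -> V) -> Prop) :
  definable (fun e => Q (e 0) (fun n => e (S n))) ->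
  exists phi r, forall x e,
    Q x e <-> sat (scons x (fun i => eval e (r i))) phi.
Proof.
  intros (phi & r & H).
  exists (rename (fun i => match r i with inl O => O | _ => S i end) phi),
    (fun i => match r i with inl (S j) => inl j | s => s end).
  intros x e. rewrite (H (scons x e)), sat_rename. apply sat_ext.
  intro i. destruct (r i) as [[|j]|c] eqn:E; simpl; rewrite ?E; reflexivity.
Qed.

Lemma definable_all (Q : V -> (nat -> V) -> Prop) :
  definable (fun e => Q (e 0) (fun n => e (S n))) ->
  definable (fun e => forall x : V, Q x e).
Proof.
  intro H. destruct (bind_variable Q H) as (phi & r & K).
  exists (fAll phi), r. intro e; simpl. split; intros L x; apply K, L.
Qed.

Lemma definable_ex (Q : V -> (nat -> V) -> Prop) :
  definable (fun e => Q (e 0) (fun n => e (S n))) ->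
  definable (fun e => exists x : V, Q x e).
Proof.
  intro H. destruct (bind_variable Q H) as (phi & r & K).
  exists (fEx phi), r. intro e; simpl. split; intros [x L]; exists x; apply K, L.
Qed.

Lemma definable_rename (P : (nat -> V) -> Prop) (f : nat -> nat) :
  definable P -> definable (fun e => P (fun n => e (f n))).
Proof.
  intros (phi & r & H).
  exists phi, (fun i => match r i with inl j => inl (f j) | s => s end).
  intro e. rewrite H. apply sat_ext. intro i.
  destruct (r i) as [j|c]; reflexivity.
Qed.

Lemma dterm_rename t (f : nat -> nat) :
  dterm t -> dterm (fun e => t (fun n => e (f n))).
Proof.
  intro H.
  exact (definable_rename _
    (fun n => match n with O => O | S m => S (f m) end) H).
Qed.

(** The value of the term is named by an existential quantifier over its graph. *)
Lemma definable_subst (Q : V -> (nat -> V) -> Prop) t :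
  definable (fun e => Q (e 0) (fun n => e (S n))) -> dterm t ->
  definable (fun e => Q (t e) e).
Proof.
  intros HQ Ht.
  apply (definable_ext (fun e => exists x, x = t e /\ Q x e)).
  - intro e. split; [intros (x & -> & H); exact H|eauto].
  - apply (definable_ex (fun x e => x = t e /\ Q x e)).
    apply definable_and; assumption.
Qed.

Lemma definable_app1 (P : V -> Prop) t :
  definable1 P -> dterm t -> definable (fun e => P (t e)).
Proof.
  intros HP Ht. exact (definable_subst (fun x _ => P x) t HP Ht).
Qed.

(** Arguments are substituted one at a time. Each substitution puts a new variable in front, which
    is why the remaining terms get shifted and the arguments end up in reverse order. *)
Lemma definable_app2 (P : V -> V -> Prop) t u :
  definable2 P -> dterm t -> dterm u -> definable (fun e => P (t e) (u e)).
Proof.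
  intros HP Ht Hu. apply (definable_subst (fun x e => P x (u e)) t); [|exact Ht].
  apply (definable_subst (fun x e => P (e 0) x)); [|exact (dterm_rename u S Hu)].
  exact (definable_rename _ (fun n => match n with O => 1 | _ => 0 end) HP).
Qed.

Lemma definable_app3 (P : V -> V -> V -> Prop) t u v :
  definable3 P -> dterm t -> dterm u -> dterm v ->
  definable (fun e => P (t e) (u e) (v e)).
Proof.
  intros HP Ht Hu Hv.
  apply (definable_subst (fun x e => P x (u e) (v e)) t); [|exact Ht].
  apply (definable_subst (fun x e => P (e 0) x (v (fun n => e (S n)))));
    [|exact (dterm_rename u S Hu)].
  apply (definable_subst (fun x e => P (e 1) (e 0) x));
    [|exact (dterm_rename v (fun n => S (S n)) Hv)].
  exact (definable_rename _
    (fun n => match n with O => 2 | 1 => 1 | _ => 0 end) HP).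
Qed.

Lemma dterm_app1 (F : V -> V) t :
  dfun1 F -> dterm t -> dterm (fun e => F (t e)).
Proof.
  intros HF Ht. apply (definable_app2 (fun y x => y = F x)); [exact HF| |].
  - apply dterm_var.
  - exact (dterm_rename t S Ht).
Qed.

Lemma dterm_app2 (F : V -> V -> V) t u :
  dfun2 F -> dterm t -> dterm u -> dterm (fun e => F (t e) (u e)).
Proof.
  intros HF Ht Hu. apply (definable_app3 (fun z x y => z = F x y)); [exact HF| | |].
  - apply dterm_var.
  - exact (dterm_rename t S Ht).
  - exact (dterm_rename u S Hu).
Qed.

End ZFModel.

(* Syntax-directed proofs of definability *)
Create HintDb definability.

Lemma definable2_mem (V : structure) : definable2 (@mem V).
Proof. exact (definable_mem_var 0 1). Qed.
Lemma definable2_eq (V : structure) : definable2 (@eq V).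
Proof. exact (definable_eq_var 0 1). Qed.
#[local] Hint Resolve definable2_mem definable2_eq : definability.

(** A hook, redefined once [sep], [image] and [the_in] have their own closure rules. *)
Ltac definability_comprehension := fail.

(** Connectives and quantifiers are split off, comprehension terms go to the hook, and any other
    predicate or function is looked up among the hints and the local hypotheses. *)
Ltac definability_step :=
  cbv beta;
  match goal with
  | |- definable (fun e => forall x : carrier _, @?Q e x) =>
      apply (definable_all (fun x e => Q e x))
  | |- definable (fun e => exists x : carrier _, @?Q e x) =>
      apply (definable_ex (fun x e => Q e x))
  | |- definable (fun e => @?P e /\ @?Q e) => apply (definable_and P Q)
  | |- definable (fun e => @?P e \/ @?Q e) => apply (definable_or P Q)
  | |- definable (fun e => @?P e <-> @?Q e) => apply (definable_iff P Q)
  | |- definable (fun e => ~ @?P e) => apply (definable_not P)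
  | |- definable (fun e => @?P e -> @?Q e) => apply (definable_imp P Q)
  | |- definable (fun _ => False) => apply definable_False
  | |- dterm (fun e => e _) => apply dterm_var
  | |- dterm (fun _ => ?c) => apply (dterm_const c)
  | |- _ => definability_comprehension
  | |- definable (fun e => ?P (@?t e) (@?u e) (@?v e)) =>
      apply (definable_app3 P t u v); [solve [auto with definability nocore]|..]
  | |- definable (fun e => ?P (@?t e) (@?u e)) =>
      apply (definable_app2 P t u); [solve [auto with definability nocore]|..]
  | |- definable (fun e => ?P (@?t e)) =>
      apply (definable_app1 P t); [solve [auto with definability nocore]|..]
  | |- dterm (fun e => ?F (@?t e) (@?u e)) =>
      apply (dterm_app2 F t u); [solve [auto with definability nocore]|..]
  | |- dterm (fun e => ?F (@?t e)) =>
      apply (dterm_app1 F t); [solve [auto with definability nocore]|..]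
  end.

Ltac definability :=
  unfold dfun1, dfun2, definable1, definable2, definable3;
  repeat definability_step.

(** * Comprehension terms from separation and replacement *)

Section ZFModel.
Context {V : structure} (hZF : ZF V).

Lemma ZF_inhabited : inhabited V.
Proof. destruct (zf_infinity V hZF) as [a _]. exact (inhabits a). Qed.

(** Junk when [P] is not the extension of a set.  Otherwise the set is unique by
    extensionality, so that this use of [epsilon] brings no choice into [V]. *)
Definition setof (P : V -> Prop) : V :=
  epsilon ZF_inhabited (fun b => forall x, x ∈ b <-> P x).

Lemma in_setof (P : V -> Prop) :
  (exists b, forall x, x ∈ b <-> P x) -> forall x, x ∈ setof P <-> P x.
Proof. exact (epsilon_spec ZF_inhabited (fun b => forall x, x ∈ b <-> P x)). Qed.

Lemma set_ext (a b : V) : (forall x, x ∈ a <-> x ∈ b) -> a = b.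
Proof. exact (zf_extensionality V hZF a b). Qed.

(** By extensionality, being equal to the comprehension term means having the elements it describes,
    which is first-order. Existence is assumed for every environment, so that the junk value never
    enters. *)
Lemma dterm_setof (P : (nat -> V) -> V -> Prop) :
  (forall e, exists b, forall x, x ∈ b <-> P e x) ->
  definable (fun e => P (fun n => e (S n)) (e 0)) ->
  dterm (fun e => setof (P e)).
Proof.
  intros H HP. apply (definable_ext
    (fun e => forall x, x ∈ e 0 <-> P (fun n => e (S n)) x)).
  - intro e. pose proof (in_setof _ (H (fun n => e (S n)))) as K. split.
    + intro L. apply set_ext. intro x. rewrite L, K. tauto.
    + intros ->. exact K.
  - apply (definable_all (fun x e => x ∈ e 0 <-> P (fun n => e (S n)) x)).
    apply definable_iff; [exact (definable_mem_var 0 1)|].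
    exact (definable_rename _ (fun n => match n with O => O | S m => S (S m) end) HP).
Qed.

Lemma separation_exists (P : (nat -> V) -> V -> Prop) a e :
  definable (fun e => P (fun n => e (S n)) (e 0)) ->
  exists b, forall x, x ∈ b <-> x ∈ a /\ P e x.
Proof.
  intro H. destruct (bind_variable (fun x e => P e x) H) as (phi & r & K).
  destruct (zf_separation V hZF phi (fun i => eval e (r i)) a) as [b Hb].
  exists b. intro x. rewrite Hb, (K x e). tauto.
Qed.

Lemma replacement_exists (F : (nat -> V) -> V -> V) a e :
  dterm (fun e => F (fun n => e (S n)) (e 0)) ->
  exists b, forall y, y ∈ b <-> exists x, x ∈ a /\ y = F e x.
Proof.
  intro H.
  assert (H' : definable (fun e => e 1 = F (fun n => e (S (S n))) (e 0))).
  { exact (definable_rename _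
      (fun n => match n with O => 1 | 1 => 0 | _ => n end) H). }
  destruct (bind_variable (fun x e => e 0 = F (fun n => e (S n)) x) H')
    as (phi & r & K).
  (* In the replacement axiom the indices 0 and 1 stand for the argument and the value, and
     parameters start at 2. Variables interpreted by the value are redirected to index 1; [a] only
     fills their now vacant places in [e']. *)
  set (e' := fun i => match r i with inl (S j) => e j | inl O => a | inr c => c end).
  set (psi := rename (fun i => match i with O => O | S j =>
    match r j with inl O => 1 | _ => S (S j) end end) phi).
  assert (L : forall x y, sat (scons x (scons y e')) psi <-> y = F e x).
  { intros x y. unfold psi. rewrite sat_rename.
    rewrite (K x (scons y e) : y = F e x <-> _). apply sat_ext.
    intros [|i]; simpl; [reflexivity|]. unfold e'.
    destruct (r i) as [[|j]|c] eqn:E; simpl; rewrite ?E; reflexivity. }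
  destruct (zf_replacement V hZF psi e' a) as [b Hb].
  - intros x _ y y'. rewrite !L. congruence.
  - exists b. intro y. rewrite Hb. split; intros (x & Hx & Hy); exists x;
      apply L in Hy || rewrite L; tauto.
Qed.

Definition sep (a : V) (P : V -> Prop) : V := setof (fun x => x ∈ a /\ P x).

Definition image (a : V) (F : V -> V) : V :=
  setof (fun y => exists x, x ∈ a /\ y = F x).

Lemma in_sep (P : V -> Prop) a x :
  definable1 P -> (x ∈ sep a P <-> x ∈ a /\ P x).
Proof.
  intro H.
  exact (in_setof _ (separation_exists (fun _ => P) a (fun _ => a) H) x).
Qed.

Lemma in_image (F : V -> V) a y :
  dfun1 F -> (y ∈ image a F <-> exists x, x ∈ a /\ y = F x).
Proof.
  intro H.
  exact (in_setof _ (replacement_exists (fun _ => F) a (fun _ => a) H) y).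
Qed.

Lemma dterm_sep t (P : (nat -> V) -> V -> Prop) :
  dterm t -> definable (fun e => P (fun n => e (S n)) (e 0)) ->
  dterm (fun e => sep (t e) (P e)).
Proof.
  intros Ht HP. apply (dterm_setof (fun e x => x ∈ t e /\ P e x)).
  - intro e. exact (separation_exists P (t e) e HP).
  - apply definable_and; [|exact HP].
    apply (definable_app2 mem (fun e => e 0) (fun e => t (fun n => e (S n))));
      [apply definable2_mem|apply dterm_var|exact (dterm_rename t S Ht)].
Qed.

Lemma dterm_image t (F : (nat -> V) -> V -> V) :
  dterm t -> dterm (fun e => F (fun n => e (S n)) (e 0)) ->
  dterm (fun e => image (t e) (F e)).
Proof.
  intros Ht HF. apply (dterm_setof (fun e y => exists x, x ∈ t e /\ y = F e x)).
  - intro e. exact (replacement_exists F (t e) e HF).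
  - apply (definable_ex (fun x e => x ∈ t (fun n => e (S n)) /\
                                    e 0 = F (fun n => e (S n)) x)).
    apply definable_and.
    + apply (definable_app2 mem (fun e => e 0) (fun e => t (fun n => e (S (S n)))));
        [apply definable2_mem|apply dterm_var|].
      exact (dterm_rename t (fun n => S (S n)) Ht).
    + exact (definable_rename _
        (fun n => match n with O => 1 | 1 => 0 | _ => n end) HF).
Qed.

Ltac definability_comprehension ::=
  match goal with
  | |- dterm (fun e => sep (@?t e) (@?P e)) => apply (dterm_sep t P)
  | |- dterm (fun e => image (@?t e) (@?F e)) => apply (dterm_image t F)
  end.

Lemma definable2_subset : definable2 (@subset V).
Proof. unfold subset. definability. Qed.
#[local] Hint Resolve definable2_subset : definability.

(** * Basic set operations and ordered pairs *)

Definition empty : V := setof (fun _ => False).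
Definition upair (a b : V) : V := setof (fun x => x = a \/ x = b).
Definition bigcup (a : V) : V := setof (fun x => exists y, y ∈ a /\ x ∈ y).
Definition power (a : V) : V := setof (fun x => subset x a).
Definition sing (a : V) : V := upair a a.
Definition opair (a b : V) : V := upair (sing a) (upair a b).
Definition cup (a b : V) : V := bigcup (upair a b).
Definition cap (a b : V) : V := sep a (fun x => x ∈ b).
Definition diff (a b : V) : V := sep a (fun x => x ∉ b).
Definition succ (a : V) : V := cup a (sing a).

Lemma upair_exists a b : exists p : V, forall x, x ∈ p <-> x = a \/ x = b.
Proof. exact (zf_pairing V hZF a b). Qed.

Lemma bigcup_exists a : exists u : V, forall x, x ∈ u <-> exists y, y ∈ a /\ x ∈ y.
Proof. exact (zf_union V hZF a). Qed.

Lemma power_exists a : exists u : V, forall x, x ∈ u <-> subset x a.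
Proof. exact (zf_powerset V hZF a). Qed.

(** The axiom of infinity supplies an empty set, so that [empty] is not junk. *)
Lemma not_in_empty x : x ∉ empty.
Proof.
  destruct (zf_infinity V hZF) as (a & (b & Hb & _) & _).
  enough (H : x ∈ empty <-> False) by tauto.
  apply in_setof. exists b. intro y. specialize (Hb y). tauto.
Qed.

Lemma in_upair a b x : x ∈ upair a b <-> x = a \/ x = b.
Proof. exact (in_setof _ (upair_exists a b) x). Qed.

Lemma in_bigcup a x : x ∈ bigcup a <-> exists y, y ∈ a /\ x ∈ y.
Proof. exact (in_setof _ (bigcup_exists a) x). Qed.

Lemma in_power a x : x ∈ power a <-> subset x a.
Proof. exact (in_setof _ (power_exists a) x). Qed.

Lemma in_sing a x : x ∈ sing a <-> x = a.
Proof. unfold sing. rewrite in_upair. tauto. Qed.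

Lemma in_cup a b x : x ∈ cup a b <-> x ∈ a \/ x ∈ b.
Proof.
  unfold cup. rewrite in_bigcup. split.
  - intros (y & Hy & Hx). apply in_upair in Hy. destruct Hy; subst; tauto.
  - intros [H|H]; [exists a|exists b]; rewrite in_upair; tauto.
Qed.

Lemma in_cap a b x : x ∈ cap a b <-> x ∈ a /\ x ∈ b.
Proof. apply (in_sep (fun x => x ∈ b)). definability. Qed.

Lemma in_diff a b x : x ∈ diff a b <-> x ∈ a /\ x ∉ b.
Proof. apply (in_sep (fun x => x ∉ b)). definability. Qed.

Lemma in_succ a x : x ∈ succ a <-> x ∈ a \/ x = a.
Proof. unfold succ. rewrite in_cup, in_sing. tauto. Qed.

Lemma dfun1_bigcup : dfun1 bigcup.
Proof.
  apply (dterm_setof (fun e x => exists y, y ∈ e 0 /\ x ∈ y)).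
  - intro e. apply bigcup_exists.
  - definability.
Qed.

Lemma dfun1_power : dfun1 power.
Proof.
  apply (dterm_setof (fun e x => subset x (e 0))).
  - intro e. apply power_exists.
  - definability.
Qed.

Lemma dfun2_upair : dfun2 upair.
Proof.
  apply (dterm_setof (fun e x => x = e 0 \/ x = e 1)).
  - intro e. apply upair_exists.
  - definability.
Qed.
#[local] Hint Resolve dfun1_bigcup dfun1_power dfun2_upair : definability.

Lemma dfun1_sing : dfun1 sing.
Proof. unfold sing. definability. Qed.
#[local] Hint Resolve dfun1_sing : definability.
Lemma dfun2_opair : dfun2 opair.
Proof. unfold opair. definability. Qed.
Lemma dfun2_cup : dfun2 cup.
Proof. unfold cup. definability. Qed.
Lemma dfun2_cap : dfun2 cap.
Proof. unfold cap. definability. Qed.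
Lemma dfun2_diff : dfun2 diff.
Proof. unfold diff. definability. Qed.
#[local] Hint Resolve dfun2_opair dfun2_cup dfun2_cap dfun2_diff : definability.
Lemma dfun1_succ : dfun1 succ.
Proof. unfold succ. definability. Qed.
#[local] Hint Resolve dfun1_succ : definability.

Lemma set_nonempty (a : V) : a <> empty -> exists x, x ∈ a.
Proof.
  intro H. apply NNPP. intro K. apply H, set_ext. intro x. split; intro L.
  - destruct K; eauto.
  - destruct (not_in_empty x L).
Qed.

Lemma is_empty_iff (a : V) : is_empty a <-> a = empty.
Proof.
  split.
  - intro H. apply set_ext. intro x. split; intro L.
    + destruct (H x L).
    + destruct (not_in_empty x L).
  - intros -> x. apply not_in_empty.
Qed.

Lemma upair_inj_r a b c : upair a b = upair a c -> b = c.
Proof.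
  intro H. assert (K : b ∈ upair a c) by (rewrite <- H; apply in_upair; tauto).
  assert (L : c ∈ upair a b) by (rewrite H; apply in_upair; tauto).
  rewrite in_upair in K, L. destruct K, L; congruence.
Qed.

Lemma opair_inj a b c d : opair a b = opair c d -> a = c /\ b = d.
Proof.
  intro H.
  assert (E : a = c).
  { assert (K : sing c ∈ opair a b) by (rewrite H; apply in_upair; tauto).
    assert (L : a ∈ sing c -> a = c) by (rewrite in_sing; tauto).
    apply L. apply in_upair in K. destruct K as [->| ->].
    - apply in_sing; reflexivity.
    - apply in_upair; tauto. }
  subst c. split; [reflexivity|].
  apply upair_inj_r in H. apply upair_inj_r in H. exact H.
Qed.

Lemma is_upair_iff p a b : is_upair p a b <-> p = upair a b.
Proof.
  split.
  - intro H. apply set_ext. intro x. rewrite (H x), in_upair. tauto.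
  - intros -> x. apply in_upair.
Qed.

Lemma is_opair_iff p a b : is_opair p a b <-> p = opair a b.
Proof.
  split.
  - intros (x & y & H & K & L). apply is_upair_iff in H, K, L. subst. reflexivity.
  - intros ->. exists (sing a), (upair a b). rewrite !is_upair_iff. tauto.
Qed.

Lemma rel_iff R a b : rel R a b <-> opair a b ∈ R.
Proof.
  split.
  - intros (p & H & K). apply is_opair_iff in H. subst; exact K.
  - intro H. exists (opair a b). rewrite is_opair_iff. tauto.
Qed.

Lemma definable_is_opair : definable3 (@is_opair V).
Proof. unfold is_opair, is_upair. definability. Qed.
#[local] Hint Resolve definable_is_opair : definability.

Lemma definable_rel : definable3 (@rel V).
Proof. unfold rel. definability. Qed.
#[local] Hint Resolve definable_rel : definability.

(** * Products, relations and definite descriptions *)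

Definition product (a b : V) : V :=
  bigcup (image a (fun x => image b (fun y => opair x y))).

Lemma in_product a b p :
  p ∈ product a b <-> exists x y, x ∈ a /\ y ∈ b /\ p = opair x y.
Proof.
  assert (H : forall x, dfun1 (fun y => opair x y)) by (intro; definability).
  unfold product. rewrite in_bigcup. split.
  - intros (z & Hz & Hp). apply in_image in Hz; [|definability].
    destruct Hz as (x & Hx & ->). apply in_image in Hp; [|apply H].
    destruct Hp as (y & Hy & ->). eauto.
  - intros (x & y & Hx & Hy & ->). exists (image b (fun y => opair x y)).
    rewrite !in_image by definability. split; eauto.
Qed.

Lemma opair_in_product a b x y : opair x y ∈ product a b <-> x ∈ a /\ y ∈ b.
Proof.
  rewrite in_product. split.
  - intros (x' & y' & Hx & Hy & E). apply opair_inj in E. destruct E; subst; tauto.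
  - intros [Hx Hy]. eauto.
Qed.

(** Turns a definable predicate into an element of [V]; all functions of the model constructed below
    arise in this way. *)
Definition relation (a b : V) (P : V -> V -> Prop) : V :=
  sep (product a b) (fun p => exists x y, p = opair x y /\ P x y).

Lemma rel_relation a b P x y : definable2 P ->
  (rel (relation a b P) x y <-> x ∈ a /\ y ∈ b /\ P x y).
Proof.
  intro H. rewrite rel_iff. unfold relation. rewrite in_sep by definability.
  rewrite opair_in_product. split.
  - intros [K (x' & y' & E & L)]. apply opair_inj in E. destruct E; subst; tauto.
  - intros (Hx & Hy & K). eauto 6.
Qed.

(** Definite description; junk unless exactly one element of [a] satisfies [P]. *)
Definition the_in (a : V) (P : V -> Prop) : V := bigcup (sep a P).

(** Here [sep a P] is the singleton of y, and its union is y. *)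
Lemma the_in_eq (P : V -> Prop) a y : definable1 P -> y ∈ a -> P y ->
  (forall z, z ∈ a -> P z -> z = y) -> the_in a P = y.
Proof.
  intros HP Hy Py U. apply set_ext. intro x. unfold the_in. rewrite in_bigcup.
  split.
  - intros (z & Hz & Hx). apply in_sep in Hz; [|exact HP].
    destruct Hz as [Hz Pz]. rewrite (U z Hz Pz) in Hx. exact Hx.
  - intro Hx. exists y. rewrite in_sep by exact HP. auto.
Qed.

Lemma the_in_spec (P : V -> Prop) a : definable1 P ->
  (exists! y, y ∈ a /\ P y) -> the_in a P ∈ a /\ P (the_in a P).
Proof.
  intros HP (y & [Hy Py] & U). rewrite (the_in_eq P a y); try tauto.
  intros z Hz Pz. symmetry. auto.
Qed.

(** * Consequences of foundation *)

Lemma not_mem_self (x : V) : x ∉ x.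
Proof.
  intro H. destruct (zf_foundation V hZF (sing x)) as (y & Hy & K).
  - exists x. apply in_sing. reflexivity.
  - apply in_sing in Hy. subst y. apply (K x H). apply in_sing. reflexivity.
Qed.

Lemma mem_asym (x y : V) : x ∈ y -> y ∉ x.
Proof.
  intros H H'. destruct (zf_foundation V hZF (upair x y)) as (z & Hz & K).
  - exists x. apply in_upair. tauto.
  - apply in_upair in Hz. destruct Hz; subst z.
    + apply (K y H'). apply in_upair. tauto.
    + apply (K x H). apply in_upair. tauto.
Qed.

Lemma succ_inj (x y : V) : succ x = succ y -> x = y.
Proof.
  intro H. assert (K : x ∈ succ y) by (rewrite <- H; apply in_succ; tauto).
  assert (L : y ∈ succ x) by (rewrite H; apply in_succ; tauto).
  rewrite in_succ in K, L. destruct K as [K|K]; [|exact K].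
  destruct L as [L|L]; [|auto]. destruct (mem_asym _ _ K L).
Qed.

Lemma succ_not_empty (x : V) : succ x <> empty.
Proof.
  intro H. apply (not_in_empty x). rewrite <- H. apply in_succ. tauto.
Qed.

Ltac definability_comprehension ::=
  match goal with
  | |- dterm (fun e => sep (@?t e) (@?P e)) => apply (dterm_sep t P)
  | |- dterm (fun e => image (@?t e) (@?F e)) => apply (dterm_image t F)
  | |- dterm (fun e => the_in (@?t e) (@?P e)) =>
      apply (dterm_app1 bigcup (fun e => sep (t e) (P e)));
      [exact dfun1_bigcup|apply (dterm_sep t P)]
  end.

(** * Functions *)

Implicit Types a b f g n m k p w x y z A B R S X Y : V.

Lemma function_rel f X Y x y : is_function f X Y -> rel f x y -> x ∈ X /\ y ∈ Y.
Proof.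
  intros [H _] K. apply rel_iff in K. destruct (H _ K) as (a & b & Ha & Hb & E).
  apply is_opair_iff, opair_inj in E. destruct E; subst; tauto.
Qed.

Lemma function_total f X Y x : is_function f X Y -> x ∈ X ->
  exists y, y ∈ Y /\ rel f x y.
Proof.
  intros H Hx. destruct (proj2 H x Hx) as (y & Hy & _). exists y.
  split; [|exact Hy]. exact (proj2 (function_rel _ _ _ _ _ H Hy)).
Qed.

Lemma function_unique f X Y x y y' : is_function f X Y ->
  rel f x y -> rel f x y' -> y = y'.
Proof.
  intros H Hy Hy'. destruct (function_rel _ _ _ _ _ H Hy) as [Hx _].
  destruct (proj2 H x Hx) as (z & _ & U). rewrite <- (U y Hy). auto.
Qed.

(** Since y ∈ {x, y} ∈ (x, y) ∈ f, every value of f lies in ⋃⋃f, so that the term need not mention a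
    codomain. *)
Definition app (f x : V) : V := the_in (bigcup (bigcup f)) (fun y => rel f x y).

Lemma dfun2_app : dfun2 app.
Proof. unfold app. definability. Qed.
#[local] Hint Resolve dfun2_app : definability.

Lemma app_eq f X Y x y : is_function f X Y -> rel f x y -> app f x = y.
Proof.
  intros H K. apply the_in_eq; [definability| |exact K|].
  - apply in_bigcup. exists (upair x y). rewrite in_upair. split; [|tauto].
    apply in_bigcup. exists (opair x y). rewrite <- rel_iff. split; [exact K|].
    unfold opair. apply in_upair. tauto.
  - intros z _ L. exact (function_unique _ _ _ _ _ _ H L K).
Qed.

Lemma app_in f X Y x : is_function f X Y -> x ∈ X ->
  app f x ∈ Y /\ rel f x (app f x).
Proof.
  intros H Hx. destruct (function_total _ _ _ _ H Hx) as (y & Hy & K).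
  rewrite (app_eq _ _ _ _ _ H K). auto.
Qed.

Lemma injection_app f X Y : is_injection f X Y ->
  (forall x, x ∈ X -> app f x ∈ Y) /\
  (forall x x', x ∈ X -> x' ∈ X -> app f x = app f x' -> x = x').
Proof.
  intros [H I]. split.
  - intros x Hx. exact (proj1 (app_in _ _ _ _ H Hx)).
  - intros x x' Hx Hx' E. apply (I x x' (app f x)); [|rewrite E];
      eapply app_in; eauto.
Qed.

Lemma relation_is_function X Y (Q : V -> V -> Prop) : definable2 Q ->
  (forall x, x ∈ X -> exists y, y ∈ Y /\ Q x y) ->
  (forall x y y', x ∈ X -> y ∈ Y -> y' ∈ Y -> Q x y -> Q x y' -> y = y') ->
  is_function (relation X Y Q) X Y.
Proof.
  intros HQ T U. split.
  - intros p Hp. unfold relation in Hp. apply in_sep in Hp; [|definability].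
    destruct Hp as [Hp _]. apply in_product in Hp. destruct Hp as (a & b & Hp).
    exists a, b. rewrite is_opair_iff. exact Hp.
  - intros x Hx. destruct (T x Hx) as (y & Hy & K). exists y. split.
    + rewrite rel_relation by exact HQ. auto.
    + intro y'. rewrite rel_relation by exact HQ. intros (_ & Hy' & K').
      exact (U x y y' Hx Hy Hy' K K').
Qed.

Lemma relation_is_injection X Y (Q : V -> V -> Prop) : definable2 Q ->
  (forall x, x ∈ X -> exists y, y ∈ Y /\ Q x y) ->
  (forall x y y', x ∈ X -> y ∈ Y -> y' ∈ Y -> Q x y -> Q x y' -> y = y') ->
  (forall x x' y, x ∈ X -> x' ∈ X -> y ∈ Y -> Q x y -> Q x' y -> x = x') ->
  is_injection (relation X Y Q) X Y.
Proof.
  intros HQ T U I. split; [apply relation_is_function; assumption|].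
  intros a a' b. rewrite !rel_relation by exact HQ.
  intros (Ha & Hb & K) (Ha' & _ & K'). exact (I a a' b Ha Ha' Hb K K').
Qed.

Lemma relation_is_bijection X Y (Q : V -> V -> Prop) : definable2 Q ->
  (forall x, x ∈ X -> exists y, y ∈ Y /\ Q x y) ->
  (forall x y y', x ∈ X -> y ∈ Y -> y' ∈ Y -> Q x y -> Q x y' -> y = y') ->
  (forall x x' y, x ∈ X -> x' ∈ X -> y ∈ Y -> Q x y -> Q x' y -> x = x') ->
  (forall y, y ∈ Y -> exists x, x ∈ X /\ Q x y) ->
  is_bijection (relation X Y Q) X Y.
Proof.
  intros HQ T U I S. split; [apply relation_is_injection; assumption|].
  intros b Hb. destruct (S b Hb) as (a & Ha & K). exists a.
  rewrite rel_relation by exact HQ. auto.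
Qed.

Lemma definable3_is_function : definable3 (@is_function V).
Proof. unfold is_function, unique. definability. Qed.
#[local] Hint Resolve definable3_is_function : definability.
Lemma definable3_is_injection : definable3 (@is_injection V).
Proof. unfold is_injection. definability. Qed.
#[local] Hint Resolve definable3_is_injection : definability.
Lemma definable3_is_bijection : definable3 (@is_bijection V).
Proof. unfold is_bijection. definability. Qed.
#[local] Hint Resolve definable3_is_bijection : definability.

(** * Natural numbers *)

Lemma is_succ_iff (y x : V) : is_succ y x <-> y = succ x.
Proof.
  split.
  - intro H. apply set_ext. intro z. rewrite (H z), in_succ. tauto.
  - intros -> z. apply in_succ.
Qed.

Lemma inductive_set_iff (a : V) : inductive_set a <->
  empty ∈ a /\ forall x, x ∈ a -> succ x ∈ a.
Proof.
  split.
  - intros [(x & Hx & K) H]. apply is_empty_iff in Hx. subst x.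
    split; [exact K|]. intros x Hx. destruct (H x Hx) as (y & Hy & L).
    apply is_succ_iff in Hy. subst y. exact L.
  - intros [H K]. split.
    + exists empty. rewrite is_empty_iff. auto.
    + intros x Hx. exists (succ x). rewrite is_succ_iff. auto.
Qed.

Lemma definable1_inductive_set : definable1 (@inductive_set V).
Proof. unfold inductive_set, is_empty, is_succ. definability. Qed.
#[local] Hint Resolve definable1_inductive_set : definability.

Definition omega : V := setof (fun x => forall a, inductive_set a -> x ∈ a).

Lemma in_omega x : x ∈ omega <-> forall a : V, inductive_set a -> x ∈ a.
Proof.
  refine (in_setof _ _ x). destruct (zf_infinity V hZF) as [I HI].
  exists (sep I (fun x => forall a, inductive_set a -> x ∈ a)).
  intro y. rewrite in_sep by definability. split; [tauto|auto].
Qed.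

Lemma is_omega_omega : is_omega omega.
Proof.
  split.
  - apply inductive_set_iff. split.
    + apply in_omega. intros a Ha. apply inductive_set_iff in Ha. tauto.
    + intros x Hx. rewrite in_omega in Hx |- *. intros a Ha.
      specialize (Hx a Ha). apply inductive_set_iff in Ha. apply Ha, Hx.
  - intros a Ha x Hx. exact (proj1 (in_omega x) Hx a Ha).
Qed.

Lemma is_omega_eq (w : V) : is_omega w -> w = omega.
Proof.
  intros [H K]. apply set_ext. intro x. split; intro L.
  - apply (K _ (proj1 is_omega_omega) x L).
  - exact (proj1 (in_omega x) L w H).
Qed.

Lemma empty_in_omega : empty ∈ omega.
Proof. apply (inductive_set_iff omega), is_omega_omega. Qed.

Lemma succ_in_omega n : n ∈ omega -> succ n ∈ omega.
Proof. apply (inductive_set_iff omega), is_omega_omega. Qed.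

(** For definable P, separation yields the set of natural numbers satisfying P, and this set is
    inductive. An arbitrary Rocq predicate would not do, since [omega] may contain nonstandard
    elements. *)
Lemma omega_ind (P : V -> Prop) : definable1 P -> P empty ->
  (forall n, n ∈ omega -> P n -> P (succ n)) -> forall n, n ∈ omega -> P n.
Proof.
  intros HP H0 HS n Hn.
  assert (K : n ∈ sep omega P).
  { apply in_omega; [exact Hn|]. apply inductive_set_iff.
    rewrite in_sep by exact HP. split; [auto using empty_in_omega|].
    intros x Hx. rewrite in_sep in Hx |- * by exact HP.
    split; [apply succ_in_omega|apply HS]; tauto. }
  rewrite in_sep in K by exact HP. tauto.
Qed.

Lemma omega_mem n m : n ∈ omega -> m ∈ n -> m ∈ omega.
Proof.
  intro Hn. revert m. revert n Hn. refine (omega_ind _ _ _ _); [definability| |].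
  - intros m Hm. destruct (not_in_empty _ Hm).
  - intros n Hn IH m Hm. apply in_succ in Hm. destruct Hm; [auto|congruence].
Qed.

Lemma omega_trans n m k : n ∈ omega -> m ∈ n -> k ∈ m -> k ∈ n.
Proof.
  intro Hn. revert m k. revert n Hn. refine (omega_ind _ _ _ _); [definability| |].
  - intros m k Hm. destruct (not_in_empty _ Hm).
  - intros n Hn IH m k Hm Hk. apply in_succ in Hm. apply in_succ.
    destruct Hm as [Hm| ->]; eauto.
Qed.

Lemma empty_least n : n ∈ omega -> empty = n \/ empty ∈ n.
Proof.
  revert n. refine (omega_ind _ _ _ _); [definability|auto|].
  intros n Hn [->|H]; right; apply in_succ; auto.
Qed.

Lemma succ_le n m : n ∈ omega -> m ∈ n -> succ m = n \/ succ m ∈ n.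
Proof.
  intro Hn. revert m. revert n Hn. refine (omega_ind _ _ _ _); [definability| |].
  - intros m Hm. destruct (not_in_empty _ Hm).
  - intros n Hn IH m Hm. apply in_succ in Hm. rewrite in_succ.
    destruct Hm as [Hm| ->]; [|auto]. destruct (IH m Hm); auto.
Qed.

Lemma omega_linear m n : m ∈ omega -> n ∈ omega -> m ∈ n \/ m = n \/ n ∈ m.
Proof.
  intro Hm. revert n. revert m Hm. refine (omega_ind _ _ _ _); [definability| |].
  - intros n Hn. destruct (empty_least n Hn); auto.
  - intros m Hm IH n Hn. rewrite in_succ. destruct (IH n Hn) as [H|[H|H]]; auto.
    destruct (succ_le n m Hn H); auto.
Qed.

Definition least (S : V) : V := the_in S (fun k => forall j, j ∈ S -> k = j \/ k ∈ j).

Lemma dfun1_least : dfun1 least.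
Proof. unfold least. definability. Qed.
#[local] Hint Resolve dfun1_least : definability.

(** Foundation gives an ∈-minimal element of S, which is the least one by linearity; asymmetry of ∈
    makes it unique, as the description demands. *)
Lemma least_spec S : subset S omega -> (exists n, n ∈ S) ->
  least S ∈ S /\ forall j, j ∈ S -> least S = j \/ least S ∈ j.
Proof.
  intros HS Hne. apply (the_in_spec (fun k => forall j, j ∈ S -> k = j \/ k ∈ j) S);
    [definability|].
  destruct (zf_foundation V hZF S Hne) as (k & Hk & K).
  assert (L : forall j, j ∈ S -> k = j \/ k ∈ j).
  { intros j Hj. destruct (omega_linear k j) as [H|[H|H]]; auto.
    destruct (K j H Hj). }
  exists k. split; [auto|]. intros j [Hj M].
  destruct (L j Hj) as [E|E]; [exact E|]. destruct (M k Hk) as [F|F]; [auto|].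
  destruct (mem_asym _ _ E F).
Qed.

(** The graph is the smallest set of pairs that contains (∅, a) and is closed under (n, x) ↦ (succ
    n, s x). Induction on n shows that it has exactly one value at each n. *)
Lemma omega_recursion A a (s : V -> V) : a ∈ A -> dfun1 s ->
  (forall x, x ∈ A -> s x ∈ A) ->
  exists F, dfun1 F /\ F empty = a /\
    forall n, n ∈ omega -> F n ∈ A /\ F (succ n) = s (F n).
Proof.
  intros Ha Hs HA.
  set (closed := fun S => opair empty a ∈ S /\
    forall n x, opair n x ∈ S -> opair (succ n) (s x) ∈ S).
  assert (Dc : definable1 closed) by (unfold closed; definability).
  set (f := sep (product omega A) (fun p => forall S, closed S -> p ∈ S)).
  assert (Hf : forall p, p ∈ f <-> p ∈ product omega A /\
    forall S, closed S -> p ∈ S) by (intro; apply in_sep; definability).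
  assert (f0 : opair empty a ∈ f).
  { apply Hf. rewrite opair_in_product.
    split; [auto using empty_in_omega|]. intros S HS. apply HS. }
  assert (fS : forall n x, opair n x ∈ f -> opair (succ n) (s x) ∈ f).
  { intros n x. rewrite !Hf, !opair_in_product. intros [[Hn Hx] K].
    split; [auto using succ_in_omega|]. intros S HS. apply HS, K, HS. }
  (* Minimality of [f]: a pair that is neither the initial one nor produced from another pair of [f]
     could be deleted without losing closure, so it is not in [f]. *)
  assert (fm : forall n x p, opair n x ∈ f -> opair n x <> p ->
    opair empty a <> p ->
    (forall m y, opair m y ∈ f -> opair m y <> p -> opair (succ m) (s y) <> p) ->
    p ∉ f).
  { intros n x p _ _ H0 HS Hp. apply Hf in Hp. destruct Hp as [_ Hp].
    assert (K : p ∈ diff f (sing p)).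
    { apply Hp. split.
      - rewrite in_diff, in_sing. auto.
      - intros m y. rewrite !in_diff, !in_sing. intros [Hm Hne]. auto. }
    rewrite in_diff, in_sing in K. tauto. }
  assert (U : forall n, n ∈ omega -> exists! x, x ∈ A /\ opair n x ∈ f).
  { apply (omega_ind (fun n => exists! x, x ∈ A /\ opair n x ∈ f)).
    - unfold unique. definability.
    - exists a. split; [auto|]. intros y [_ Hy]. apply NNPP. intro Hne.
      revert Hy. apply (fm empty a); [exact f0| | |].
      + intro E. apply opair_inj in E. tauto.
      + intro E. apply opair_inj in E. tauto.
      + intros m z _ _ E. apply opair_inj in E.
        destruct (succ_not_empty _ (proj1 E)).
    - intros n Hn (x & [Hx Kx] & U). exists (s x). split; [auto|].
      intros y [_ Hy]. apply NNPP. intro Hne. revert Hy.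
      apply (fm n x); [exact Kx| | |].
      + intro E. apply opair_inj in E. destruct E as [E _].
        apply (not_mem_self n). rewrite E at 2. apply in_succ. auto.
      + intro E. apply opair_inj in E. destruct E as [E _].
        symmetry in E. destruct (succ_not_empty _ E).
      + intros m z Hz _ E. apply opair_inj in E. destruct E as [E1 E2].
        apply succ_inj in E1. subst m. apply Hne. rewrite <- E2. f_equal.
        apply U. split; [|exact Hz]. apply Hf in Hz.
        rewrite opair_in_product in Hz. tauto. }
  set (F := fun n => the_in A (fun x => opair n x ∈ f)).
  assert (HF : forall n, n ∈ omega -> F n ∈ A /\ opair n (F n) ∈ f).
  { intros n Hn. apply (the_in_spec (fun x => opair n x ∈ f)); [definability|auto]. }
  assert (E : forall n x, n ∈ omega -> x ∈ A -> opair n x ∈ f -> F n = x).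
  { intros n x Hn Hx K. destruct (U n Hn) as (y & _ & Uy).
    rewrite <- (Uy x), <- (Uy (F n)); auto. }
  exists F. split; [unfold F; definability|].
  split; [apply E; auto using empty_in_omega|].
  intros n Hn. destruct (HF n Hn) as [H1 H2]. split; [exact H1|].
  apply E; auto using succ_in_omega.
Qed.

(** * Finite and countable sets *)

Lemma finite_iff X : finite X <-> exists n f, n ∈ omega /\ is_bijection f n X.
Proof.
  split.
  - intros (w & n & f & Hw & H). apply is_omega_eq in Hw. subst w. eauto.
  - intros (n & f & H). exists omega, n, f. split; [exact is_omega_omega|exact H].
Qed.

Lemma definable1_finite : definable1 (@finite V).
Proof. unfold finite, is_omega. definability. Qed.
#[local] Hint Resolve definable1_finite : definability.

Lemma finite_empty : finite empty.
Proof.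
  apply finite_iff. exists empty, (relation empty empty (fun x y => x = y)).
  split; [exact empty_in_omega|].
  apply relation_is_bijection; [definability|..];
    intros x; try (intros y z Hx); try intro Hx;
    destruct (not_in_empty _ Hx).
Qed.

Lemma finite_add A a : finite A -> finite (cup A (sing a)).
Proof.
  intro HA. destruct (classic (a ∈ A)) as [Ha|Ha].
  { replace (cup A (sing a)) with A; [exact HA|]. apply set_ext. intro x.
    rewrite in_cup, in_sing. split; [auto|]. intros [Hx| ->]; assumption. }
  apply finite_iff in HA. destruct HA as (n & f & Hn & [[Hf I] S]).
  assert (Hin : forall x y, rel f x y -> x ∈ n /\ y ∈ A)
    by (intros x y; apply function_rel; exact Hf).
  apply finite_iff. exists (succ n), (relation (succ n) (cup A (sing a))
    (fun x y => rel f x y \/ x = n /\ y = a)).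
  split; [apply succ_in_omega, Hn|].
  apply relation_is_bijection; [definability|..].
  - intros x Hx. apply in_succ in Hx. destruct Hx as [Hx| ->].
    + destruct (function_total _ _ _ _ Hf Hx) as (y & Hy & K).
      exists y. rewrite in_cup. auto.
    + exists a. rewrite in_cup, in_sing. auto.
  - intros x y y' _ _ _ [H|[-> ->]] [K|[K1 K2]]; subst; auto.
    + exact (function_unique _ _ _ _ _ _ Hf H K).
    + destruct (Hin _ _ H) as [L _]. destruct (not_mem_self _ L).
    + destruct (Hin _ _ K) as [L _]. destruct (not_mem_self _ L).
  - intros x x' y _ _ _ [H|[-> ->]] [K|[K1 K2]]; subst; auto.
    + exact (I _ _ _ H K).
    + destruct (Ha (proj2 (Hin _ _ H))).
    + destruct (Ha (proj2 (Hin _ _ K))).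
  - intros y Hy. rewrite in_cup, in_sing in Hy. destruct Hy as [Hy| ->].
    + destruct (S y Hy) as [x Hx]. exists x. rewrite in_succ.
      split; [left; apply (Hin _ _ Hx)|auto].
    + exists n. rewrite in_succ. auto.
Qed.

(** Induction on the number of elements: deleting the value at n of a bijection defined on [succ n]
    leaves a set in bijection with n. *)
Lemma finite_ind (P : V -> Prop) : definable1 P -> P empty ->
  (forall A a, finite A -> a ∉ A -> P A -> P (cup A (sing a))) ->
  forall A, finite A -> P A.
Proof.
  intros HP H0 HS A HA. apply finite_iff in HA. destruct HA as (n & f & Hn & H).
  revert A f H. revert n Hn. refine (omega_ind _ _ _ _); [definability| |].
  - intros A f [[Hf _] S]. replace A with empty; [exact H0|].
    apply set_ext. intro y. split; intro Hy; [destruct (not_in_empty _ Hy)|].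
    destruct (S y Hy) as [x Hx]. apply (function_rel _ _ _ _ _ Hf) in Hx.
    destruct (not_in_empty _ (proj1 Hx)).
  - intros n Hn IH A f [[Hf I] S].
    assert (Hnn : n ∈ succ n) by (apply in_succ; auto).
    destruct (app_in _ _ _ _ Hf Hnn) as [Ha Ra]. set (a := app f n) in *.
    set (A' := diff A (sing a)).
    assert (HA' : forall x, x ∈ A' <-> x ∈ A /\ x <> a)
      by (intro x; unfold A'; rewrite in_diff, in_sing; tauto).
    assert (B : is_bijection (relation n A' (fun x y => rel f x y)) n A').
    { apply relation_is_bijection; [definability|..].
      - intros x Hx. assert (Hx' : x ∈ succ n) by (apply in_succ; auto).
        destruct (app_in _ _ _ _ Hf Hx') as [Hy Ry]. exists (app f x).
        rewrite HA'. split; [split; [exact Hy|]|exact Ry].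
        intro E. rewrite E in Ry. rewrite (I _ _ _ Ry Ra) in Hx.
        exact (not_mem_self _ Hx).
      - intros x y y' _ _ _. exact (function_unique _ _ _ _ _ _ Hf).
      - intros x x' y _ _ _. apply I.
      - intros y Hy. apply HA' in Hy. destruct Hy as [Hy Hne].
        destruct (S y Hy) as [x Rx]. exists x. split; [|exact Rx].
        destruct (function_rel _ _ _ _ _ Hf Rx) as [Hx _].
        apply in_succ in Hx. destruct Hx as [Hx| ->]; [exact Hx|].
        destruct Hne. exact (function_unique _ _ _ _ _ _ Hf Rx Ra). }
    replace A with (cup A' (sing a)).
    + apply HS; [|rewrite HA'; tauto|exact (IH _ _ B)].
      apply finite_iff. eauto.
    + apply set_ext. intro x. rewrite in_cup, in_sing, HA'.
      split; [intros [H| ->]; tauto|]. destruct (classic (x = a)); tauto.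
Qed.

Lemma finite_subset A B : finite A -> subset B A -> finite B.
Proof.
  intro HA. revert B. revert A HA. refine (finite_ind _ _ _ _); [definability| |].
  - intros B HB. replace B with empty; [exact finite_empty|].
    apply set_ext. intro x. split; [|apply HB].
    intro Hx. destruct (not_in_empty _ Hx).
  - intros A a _ Ha IH B HB.
    destruct (classic (a ∈ B)) as [K|K].
    + replace B with (cup (diff B (sing a)) (sing a)).
      * apply finite_add, IH. intros x Hx. rewrite in_diff, in_sing in Hx.
        destruct Hx as [Hx Hne]. specialize (HB x Hx).
        rewrite in_cup, in_sing in HB. tauto.
      * apply set_ext. intro x. rewrite in_cup, in_diff, in_sing.
        split; [intros [H| ->]; tauto|]. destruct (classic (x = a)); tauto.
    + apply IH. intros x Hx. specialize (HB x Hx).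
      rewrite in_cup, in_sing in HB. destruct HB as [HB| ->]; tauto.
Qed.

Lemma finite_cup A B : finite A -> finite B -> finite (cup A B).
Proof.
  intro HA. revert B. refine (finite_ind _ _ _ _); [definability| |].
  - apply (finite_subset A); [exact HA|]. intros x Hx. apply in_cup in Hx.
    destruct Hx as [Hx|Hx]; [exact Hx|destruct (not_in_empty _ Hx)].
  - intros B b _ _ IH. apply (finite_subset (cup (cup A B) (sing b))).
    + apply finite_add, IH.
    + intros x. rewrite !in_cup. tauto.
Qed.

Lemma finite_sing a : finite (sing a).
Proof.
  apply (finite_subset _ _ (finite_add empty a finite_empty)).
  intros x Hx. apply in_cup. auto.
Qed.

Lemma infinite_diff A B : infinite A -> finite B -> infinite (diff A B).
Proof.
  intros HA HB H. apply HA. apply (finite_subset _ _ (finite_cup _ _ H HB)).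
  intros x Hx. rewrite in_cup, in_diff. destruct (classic (x ∈ B)); tauto.
Qed.

Lemma finite_image A (F : V -> V) : dfun1 F -> finite A -> finite (image A F).
Proof.
  intro HF. revert A. refine (finite_ind _ _ _ _); [definability| |].
  - apply (finite_subset _ _ finite_empty). intros y Hy.
    apply in_image in Hy; [|exact HF]. destruct Hy as (x & Hx & _).
    destruct (not_in_empty _ Hx).
  - intros A a _ _ IH. apply (finite_subset _ _ (finite_add _ (F a) IH)).
    intros y. rewrite in_cup, in_sing, !in_image by exact HF.
    intros (x & Hx & ->). rewrite in_cup, in_sing in Hx.
    destruct Hx as [Hx| ->]; eauto.
Qed.

(** The inverse of F is a definite description, hence definable, and A is contained in the image of
    B under it. *)
Lemma finite_of_injective A B (F : V -> V) : dfun1 F ->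
  (forall x, x ∈ A -> F x ∈ B) ->
  (forall x x', x ∈ A -> x' ∈ A -> F x = F x' -> x = x') ->
  finite B -> finite A.
Proof.
  intros HF FB I HB.
  assert (HG : dfun1 (fun y => the_in A (fun x => F x = y))) by definability.
  apply (finite_subset _ _ (finite_image _ _ HG HB)). intros x Hx.
  apply in_image; [exact HG|]. exists (F x). split; [auto|].
  symmetry. apply the_in_eq; [definability|auto|auto|].
  intros z Hz E. exact (I _ _ Hz Hx E).
Qed.

Lemma finite_bigcup A : finite A -> (forall B, B ∈ A -> finite B) -> finite (bigcup A).
Proof.
  revert A. refine (finite_ind _ _ _ _); [definability| |].
  - intros _. apply (finite_subset _ _ finite_empty). intros x Hx.
    apply in_bigcup in Hx. destruct Hx as (y & Hy & _).
    destruct (not_in_empty _ Hy).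
  - intros A a _ _ IH H.
    assert (HA : finite (bigcup A))
      by (apply IH; intros B HB; apply H, in_cup; auto).
    assert (Ha : finite a) by (apply H; rewrite in_cup, in_sing; auto).
    apply (finite_subset _ _ (finite_cup _ _ HA Ha)). intros x Hx.
    apply in_bigcup in Hx. destruct Hx as (y & Hy & Hx).
    rewrite in_cup, in_sing in Hy. rewrite in_cup, in_bigcup.
    destruct Hy as [Hy| ->]; eauto.
Qed.

Lemma finite_power A : finite A -> finite (power A).
Proof.
  revert A. refine (finite_ind _ _ _ _); [definability| |].
  - apply (finite_subset _ _ (finite_sing empty)). intros x Hx.
    apply in_power in Hx. apply in_sing, is_empty_iff. intros y Hy.
    exact (not_in_empty _ (Hx y Hy)).
  - intros A a _ _ IH.
    assert (HF : dfun1 (fun B => cup B (sing a))) by definability.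
    apply (finite_subset _ _ (finite_cup _ _ IH (finite_image _ _ HF IH))).
    intros B HB. apply in_power in HB. rewrite in_cup, in_image by exact HF.
    assert (K : diff B (sing a) ∈ power A).
    { apply in_power. intros x Hx. rewrite in_diff, in_sing in Hx.
      destruct Hx as [Hx Hne]. specialize (HB x Hx).
      rewrite in_cup, in_sing in HB. tauto. }
    destruct (classic (a ∈ B)) as [Ha|Ha]; [right|left].
    + exists (diff B (sing a)). split; [exact K|]. apply set_ext. intro x.
      rewrite in_cup, in_diff, in_sing.
      split; [|intros [H| ->]; tauto]. destruct (classic (x = a)); tauto.
    + replace B with (diff B (sing a)); [exact K|]. apply set_ext. intro x.
      rewrite in_diff, in_sing. split; [tauto|]. intro Hx.
      split; [exact Hx|]. intros ->. exact (Ha Hx).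
Qed.

Lemma finite_nat n : n ∈ omega -> finite n.
Proof.
  revert n. refine (omega_ind _ _ _ _); [definability|exact finite_empty|].
  intros n _ Hn. exact (finite_add n n Hn).
Qed.

Lemma finite_bounded A : finite A -> subset A omega ->
  exists n, n ∈ omega /\ subset A n.
Proof.
  revert A. refine (finite_ind _ _ _ _); [definability| |].
  - intros _. exists empty. split; [exact empty_in_omega|]. intros x Hx; exact Hx.
  - intros A a _ _ IH H. destruct IH as (n & Hn & K).
    { intros x Hx. apply H, in_cup. auto. }
    assert (Ha : a ∈ omega) by (apply H; rewrite in_cup, in_sing; auto).
    assert (L : forall m k, m ∈ k -> k ∈ omega -> subset m k)
      by (intros m k Hm Hk x; exact (omega_trans k m x Hk Hm)).
    destruct (omega_linear a n Ha Hn) as [C|C].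
    + exists n. split; [exact Hn|]. intros x Hx. rewrite in_cup, in_sing in Hx.
      destruct Hx as [Hx| ->]; auto.
    + exists (succ a). split; [exact (succ_in_omega a Ha)|]. intros x Hx.
      rewrite in_cup, in_sing in Hx. apply in_succ. destruct Hx as [Hx|Hx]; [|auto].
      specialize (K x Hx). left. destruct C as [C|C]; [congruence|].
      exact (L n a C Ha x K).
Qed.

Lemma infinite_unbounded A : subset A omega ->
  (forall n, n ∈ omega -> exists m, m ∈ A /\ m ∉ n) -> infinite A.
Proof.
  intros HA H F. destruct (finite_bounded A F HA) as (n & Hn & K).
  destruct (H n Hn) as (m & Hm & L). exact (L (K m Hm)).
Qed.

Lemma infinite_omega : infinite omega.
Proof.
  apply infinite_unbounded; [intros x Hx; exact Hx|]. intros n Hn. exists n.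
  split; [exact Hn|apply not_mem_self].
Qed.

Lemma infinite_of_injective A (F : V -> V) : dfun1 F ->
  (forall n, n ∈ omega -> F n ∈ A) ->
  (forall n m, n ∈ omega -> m ∈ omega -> F n = F m -> n = m) -> infinite A.
Proof.
  intros HF FA I HA. exact (infinite_omega (finite_of_injective _ _ F HF FA I HA)).
Qed.

(** Trades an injection inside the model for a definable operation, which can be composed and used
    directly in [sep] and [image]. *)
Lemma countable_iff A : countable A <-> exists g : V -> V, dfun1 g /\
  (forall x, x ∈ A -> g x ∈ omega) /\
  (forall x x', x ∈ A -> x' ∈ A -> g x = g x' -> x = x').
Proof.
  split.
  - intros (w & f & Hw & Hf). apply is_omega_eq in Hw. subst w. exists (app f).
    split; [definability|exact (injection_app _ _ _ Hf)].
  - intros (g & Hg & K & I). exists omega, (relation A omega (fun x y => y = g x)).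
    split; [exact is_omega_omega|].
    apply relation_is_injection; [definability|eauto|congruence|].
    intros x x' y Hx Hx' _ -> E. exact (I _ _ Hx Hx' E).
Qed.

Lemma countable_omega : countable omega.
Proof.
  apply countable_iff. exists (fun x => x). split; [definability|auto].
Qed.

Lemma countable_subset A B : countable A -> subset B A -> countable B.
Proof.
  rewrite !countable_iff. intros (g & Hg & K & I) H. exists g. auto 6.
Qed.

(** A point of the image is numbered by the least number of its preimages, so that no preimage has
    to be chosen. *)
Lemma countable_image A (F : V -> V) : dfun1 F -> countable A -> countable (image A F).
Proof.
  intros HF. rewrite !countable_iff. intros (g & Hg & K & I).
  set (S := fun y => image (sep A (fun x => F x = y)) g).
  assert (DS : dfun1 S) by (unfold S; definability).
  assert (HS : forall y n, n ∈ S y <-> exists x, (x ∈ A /\ F x = y) /\ n = g x).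
  { intros y n. unfold S. rewrite in_image by exact Hg.
    assert (K' : forall x, x ∈ sep A (fun x => F x = y) <-> x ∈ A /\ F x = y)
      by (intro; apply (in_sep (fun x => F x = y)); definability).
    split; intros (x & Hx & E); exists x; (split; [apply K', Hx|exact E]). }
  assert (L : forall y, y ∈ image A F -> least (S y) ∈ S y /\ least (S y) ∈ omega).
  { intros y Hy. assert (SO : subset (S y) omega).
    { intros n Hn. apply HS in Hn. destruct Hn as (x & [Hx _] & ->). auto. }
    assert (M : least (S y) ∈ S y); [|auto].
    apply least_spec; [exact SO|]. apply in_image in Hy; [|exact HF].
    destruct Hy as (x & Hx & ->). exists (g x). apply HS. eauto. }
  exists (fun y => least (S y)). split; [definability|]. split.
  - intros y Hy. apply (L y Hy).
  - intros y y' Hy Hy' E. destruct (L y Hy) as [H _]. destruct (L y' Hy') as [H' _].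
    rewrite <- E in H'. apply HS in H, H'.
    destruct H as (x & [Hx <-] & Ex). destruct H' as (x' & [Hx' <-] & Ex').
    f_equal. apply I; auto. congruence.
Qed.

(** * Well-ordered and amorphous sets *)

(** The elements with finitely many predecessors form a set [A0] without a last element, and
    iterating the successor in [A0] from the least element of A gives a strictly increasing
    sequence. *)
Lemma well_orders_omega A R : well_orders R A -> infinite A ->
  exists F, dfun1 F /\ (forall n, n ∈ omega -> F n ∈ A) /\
    (forall n m, n ∈ omega -> m ∈ omega -> F n = F m -> n = m).
Proof.
  intros (irr & tr & tot & wf) HA.
  assert (Dm : forall Y, definable1 (fun m => forall y, y ∈ Y -> m = y \/ rel R m y))
    by (intro; definability).
  set (below := fun x => sep A (fun y => rel R y x)).
  assert (Db : dfun1 below) by (unfold below; definability).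
  assert (Hb : forall x y, y ∈ below x <-> y ∈ A /\ rel R y x)
    by (intros; apply (in_sep (fun y => rel R y x)); definability).
  set (A0 := sep A (fun x => finite (below x))).
  assert (H0 : forall x, x ∈ A0 <-> x ∈ A /\ finite (below x))
    by (intro; apply (in_sep (fun x => finite (below x))); definability).
  assert (A0A : subset A0 A) by (intros x Hx; apply H0; exact Hx).
  set (above := fun x => sep A0 (fun y => rel R x y)).
  assert (Ha : forall x y, y ∈ above x <-> y ∈ A0 /\ rel R x y)
    by (intros x y; apply (in_sep (fun y => rel R x y)); definability).
  (* A last element x would make [A0] finite. The least element of A outside [A0] would then have
     all its predecessors in the finite set [A0], and so belong to [A0]. *)
  assert (ne : forall x, x ∈ A0 -> exists y, y ∈ above x).
  { intros x Hx. apply NNPP. intro K. pose proof Hx as Hx'. apply H0 in Hx'.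
    assert (F0 : finite A0).
    { apply (finite_subset _ _ (finite_add _ x (proj2 Hx'))). intros y Hy.
      rewrite in_cup, in_sing, Hb.
      destruct (tot x y (proj1 Hx') (A0A y Hy)) as [H|[H|H]]; [|auto|auto].
      destruct K. exists y. apply Ha. auto. }
    destruct (wf (diff A A0)) as (m & Hm & M).
    - intros y Hy. apply in_diff in Hy. tauto.
    - apply NNPP. intro E. apply HA. apply (finite_subset _ _ F0). intros y Hy.
      apply NNPP. intro L. apply E. exists y. apply in_diff. auto.
    - apply in_diff in Hm. destruct Hm as [Hm Hm0]. apply Hm0, H0.
      split; [exact Hm|]. apply (finite_subset _ _ F0). intros y Hy.
      apply Hb in Hy. destruct Hy as [Hy L]. apply NNPP. intro Hy0.
      destruct (M y) as [E|E]; [apply in_diff; auto| |].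
      + subst y. exact (irr m Hm L).
      + exact (irr m Hm (tr m y m Hm Hy Hm E L)). }
  set (s := fun x => the_in (above x) (fun m => forall y, y ∈ above x ->
    m = y \/ rel R m y)).
  assert (Hs : forall x, x ∈ A0 -> s x ∈ A0 /\ rel R x (s x)).
  { intros x Hx. apply Ha. apply the_in_spec; [apply Dm|].
    assert (sub : subset (above x) A) by (intros y Hy; apply Ha in Hy; apply A0A, Hy).
    destruct (wf (above x) sub (ne x Hx)) as (m & Hm & M).
    exists m. split; [auto|]. intros m' [Hm' M'].
    destruct (M m' Hm') as [E|E]; [exact E|].
    destruct (M' m Hm) as [E'|E']; [auto|].
    pose proof (sub m Hm). pose proof (sub m' Hm').
    destruct (irr m); [assumption|]. apply (tr m m' m); assumption. }
  assert (Ds : dfun1 s) by (unfold s, above; definability).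
  assert (start : exists a, a ∈ A0).
  { destruct (wf A) as (m & Hm & M).
    - intros x Hx; exact Hx.
    - apply set_nonempty. intros ->. exact (HA finite_empty).
    - exists m. apply H0. split; [exact Hm|].
      apply (finite_subset _ _ finite_empty). intros y Hy. apply Hb in Hy.
      destruct Hy as [Hy L]. destruct (irr m); [exact Hm|].
      destruct (M y Hy) as [E|E]; [congruence|]. apply (tr m y m); assumption. }
  destruct start as [a0 Ha0].
  destruct (omega_recursion A0 a0 s Ha0 Ds (fun x Hx => proj1 (Hs x Hx)))
    as (F & DF & _ & HF).
  exists F. split; [exact DF|].
  assert (FA : forall n, n ∈ omega -> F n ∈ A) by (intros n Hn; apply A0A, HF, Hn).
  split; [exact FA|].
  assert (inc : forall m, m ∈ omega -> forall n, n ∈ m -> rel R (F n) (F m)).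
  { refine (omega_ind _ _ _ _); [definability| |].
    - intros n Hn. destruct (not_in_empty _ Hn).
    - intros m Hm IH n Hn. destruct (HF m Hm) as [K ->].
      destruct (Hs _ K) as [K' L].
      apply in_succ in Hn. destruct Hn as [Hn| ->]; [|exact L].
      apply (tr _ (F m)); auto. apply FA, (omega_mem m n Hm Hn). }
  intros n m Hn Hm E. destruct (omega_linear n m Hn Hm) as [L|[L|L]]; [|exact L|].
  - pose proof (inc m Hm n L) as K. rewrite E in K. destruct (irr (F m)); auto.
  - pose proof (inc n Hn m L) as K. rewrite E in K. destruct (irr (F m)); auto.
Qed.

(** The order of ω, pulled back along the numbering, well-orders A. *)
Lemma countable_infinite_omega A : countable A -> infinite A ->
  exists F, dfun1 F /\ (forall n, n ∈ omega -> F n ∈ A) /\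
    (forall n m, n ∈ omega -> m ∈ omega -> F n = F m -> n = m).
Proof.
  intros HA. apply countable_iff in HA. destruct HA as (g & Hg & K & I).
  apply (well_orders_omega A (relation A A (fun x y => g x ∈ g y))).
  assert (H : forall x y, rel (relation A A (fun x y => g x ∈ g y)) x y <->
    x ∈ A /\ y ∈ A /\ g x ∈ g y)
    by (intros; apply (rel_relation A A (fun x y => g x ∈ g y)); definability).
  split; [|split; [|split]].
  - intros x Hx. rewrite H. intros (_ & _ & L). exact (not_mem_self _ L).
  - intros x y z Hx Hy Hz. rewrite !H. intros (_ & _ & L) (_ & _ & M).
    split; [exact Hx|]. split; [exact Hz|].
    exact (omega_trans _ _ _ (K z Hz) M L).
  - intros x y Hx Hy. rewrite !H.
    destruct (omega_linear _ _ (K x Hx) (K y Hy)) as [L|[L|L]]; auto.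
  - intros Y HY [y Hy].
    assert (sub : subset (image Y g) omega).
    { intros n Hn. apply in_image in Hn; [|exact Hg].
      destruct Hn as (z & Hz & ->). auto. }
    destruct (least_spec (image Y g) sub) as [L M].
    { exists (g y). apply in_image; eauto. }
    apply in_image in L; [|exact Hg]. destruct L as (m & Hm & Em).
    exists m. split; [exact Hm|]. intros z Hz. rewrite H.
    destruct (M (g z)) as [E|E]; [apply in_image; eauto| |];
      rewrite Em in E; auto.
Qed.

(** Complementation in {∅} toggles between ∅ and {∅}; iterated from ∅ it computes parity. Of n and
    [succ n] exactly one is in [E], so both parts are unbounded. *)
Lemma omega_split : exists E, subset E omega /\ infinite E /\ infinite (diff omega E).
Proof.
  destruct (omega_recursion (power (sing empty)) empty (diff (sing empty)))
    as (F & DF & _ & HF).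
  - apply in_power. intros x Hx. destruct (not_in_empty _ Hx).
  - definability.
  - intros x _. apply in_power. intros y Hy. apply in_diff in Hy. tauto.
  - set (E := sep omega (fun n => empty ∈ F n)).
    assert (HE : forall n, n ∈ E <-> n ∈ omega /\ empty ∈ F n)
      by (intro; refine (in_sep _ _ _ _); definability).
    assert (HS : forall n, n ∈ omega -> (succ n ∈ E <-> n ∉ E)).
    { intros n Hn. rewrite !HE, (proj2 (HF n Hn)), in_diff, in_sing.
      pose proof (succ_in_omega n Hn). tauto. }
    assert (Hout : forall n, succ n ∉ n).
    { intros n K. apply (mem_asym _ _ K). apply in_succ. auto. }
    exists E. split; [intros n Hn; apply HE in Hn; tauto|].
    split; apply infinite_unbounded.
    + intros n Hn; apply HE in Hn; tauto.
    + intros n Hn. destruct (classic (n ∈ E)) as [K|K].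
      * exists n. split; [exact K|apply not_mem_self].
      * exists (succ n). rewrite HS by exact Hn. auto.
    + intros n Hn. apply in_diff in Hn. tauto.
    + intros n Hn. destruct (classic (n ∈ E)) as [K|K].
      * exists (succ n). rewrite in_diff, HS by exact Hn.
        auto using succ_in_omega.
      * exists n. rewrite in_diff. split; [auto|apply not_mem_self].
Qed.

(** The image of A is an infinite subset of ω and contains a sequence of distinct numbers. Splitting
    the indices of that sequence and pulling back along r splits A. *)
Lemma finite_to_one_split A (r : V -> V) : infinite A -> dfun1 r ->
  (forall x, x ∈ A -> r x ∈ omega) ->
  (forall n, n ∈ omega -> finite (sep A (fun x => r x ∈ n))) ->
  exists B, subset B A /\ infinite B /\ infinite (diff A B).
Proof.
  intros HA Dr Hr fin.
  assert (sub : subset (image A r) omega).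
  { intros n Hn. apply in_image in Hn; [|exact Dr]. destruct Hn as (x & Hx & ->). auto. }
  assert (inf : infinite (image A r)).
  { intro K. destruct (finite_bounded _ K sub) as (n & Hn & L). apply HA.
    apply (finite_subset _ _ (fin n Hn)). intros x Hx.
    rewrite in_sep by definability. split; [exact Hx|].
    apply L, in_image; eauto. }
  destruct (countable_infinite_omega _ (countable_subset _ _ countable_omega sub) inf)
    as (F & DF & HF & I).
  destruct omega_split as (E & HE & IE & IO).
  set (B := sep A (fun x => exists n, n ∈ E /\ r x = F n)).
  assert (HB : forall x, x ∈ B <-> x ∈ A /\ exists n, n ∈ E /\ r x = F n)
    by (intro; refine (in_sep _ _ _ _); definability).
  (* A set that contains the whole fibre over [F n] for infinitely many n has an infinite image
     under r. *)
  assert (L : forall C D, subset C omega -> infinite C ->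
    (forall x n, x ∈ A -> n ∈ C -> r x = F n -> x ∈ D) -> infinite D).
  { intros C D HC IC K FD. apply IC.
    apply (finite_of_injective C (image D r) F DF); [| |exact (finite_image _ _ Dr FD)].
    - intros n Hn. pose proof (HF n (HC n Hn)) as M. apply in_image in M; [|exact Dr].
      destruct M as (x & Hx & Ex). apply in_image; [exact Dr|]. eauto.
    - intros n m Hn Hm. auto. }
  exists B. split; [intros x Hx; apply HB in Hx; tauto|]. split.
  - apply (L E); [exact HE|exact IE|]. intros x n Hx Hn Ex. apply HB. eauto.
  - apply (L (diff omega E)); [|exact IO|].
    + intros n Hn. apply in_diff in Hn. tauto.
    + intros x n Hx Hn Ex. apply in_diff in Hn. rewrite in_diff, HB.
      split; [exact Hx|]. intros (_ & m & Hm & Em). apply (proj2 Hn).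
      rewrite (I n m); [exact Hm|tauto|auto|congruence].
Qed.

(** * Ultrafilters from the Boolean prime ideal principle *)

Section Ultrafilter.
Context (W C : V).

(** Inclusion up to the filter generated by [C]. *)
Let le A B : Prop := exists E, E ∈ C /\ subset (cap A E) B.

(** Elements of the quotient of the power set of W by the filter generated by C. *)
Let cls A : V := sep (power W) (fun B => le A B /\ le B A).

Let algebra : V := image (power W) cls.

Let order : V := relation algebra algebra
  (fun a b => exists A B, A ∈ power W /\ B ∈ power W /\ a = cls A /\ b = cls B /\ le A B).

(** In the quotient algebra every member of C becomes the top element. The sets whose class lies
    outside a prime ideal therefore form an ultrafilter that contains C. *)
Lemma ultrafilter_exists : BPI V ->
  (exists E, E ∈ C) ->
  (forall E, E ∈ C -> subset E W) ->
  (forall E, E ∈ C -> exists s, s ∈ E) ->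
  (forall E E', E ∈ C -> E' ∈ C -> exists E'', E'' ∈ C /\ subset E'' (cap E E')) ->
  exists U : V,
    (forall E, E ∈ C -> E ∈ U) /\ empty ∉ U /\
    (forall A B, A ∈ U -> subset A B -> subset B W -> B ∈ U) /\
    (forall A B, A ∈ U -> B ∈ U -> cap A B ∈ U) /\
    (forall A B, subset A W -> subset B W -> cup A B ∈ U -> A ∈ U \/ B ∈ U).
Proof.
  intros bpi [E0 HE0] CW Cne Cdir.
  assert (Dle : definable2 le) by (unfold le; definability).
  assert (Dc : dfun1 cls) by (unfold cls, le; definability).
  assert (sub_le : forall A B, subset A B -> le A B).
  { intros A B H. exists E0. split; [exact HE0|]. intros x Hx.
    apply in_cap in Hx. apply H, Hx. }
  assert (le_refl : forall A, le A A) by (intro A; apply sub_le; intros x Hx; exact Hx).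
  (* Directedness of C gives one witness for two inequalities. *)
  assert (le_both : forall A B A' B', le A A' -> le B B' -> exists E, E ∈ C /\
    subset (cap A E) A' /\ subset (cap B E) B').
  { intros A B A' B' (E & HE & H) (E' & HE' & H').
    destruct (Cdir E E' HE HE') as (E'' & HE'' & K). exists E''.
    split; [exact HE''|]. split; intros x Hx; apply in_cap in Hx; destruct Hx as [Hx L];
      apply K, in_cap in L; [apply H|apply H']; apply in_cap; tauto. }
  assert (le_trans : forall A B D, le A B -> le B D -> le A D).
  { intros A B D H K. destruct (le_both _ _ _ _ H K) as (E & HE & L & M).
    exists E. split; [exact HE|]. intros x Hx. apply M. rewrite in_cap in *.
    split; [|tauto]. apply L. apply in_cap. exact Hx. }
  assert (Hcls : forall A B, B ∈ cls A <-> B ∈ power W /\ (le A B /\ le B A)).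
  { intros A B. apply (in_sep (fun B => le A B /\ le B A)). definability. }
  assert (cls_eq : forall A B, B ∈ power W -> cls A = cls B -> le A B /\ le B A).
  { intros A B HB E. apply (Hcls A B). rewrite E. apply Hcls. auto. }
  assert (cls_intro : forall A B, le A B -> le B A -> cls A = cls B).
  { intros A B H K. apply set_ext. intro D. rewrite !Hcls.
    split; intros (HD & L & M); eauto 6. }
  assert (Hal : forall a, a ∈ algebra <-> exists A, A ∈ power W /\ a = cls A)
    by (intro; apply in_image, Dc).
  assert (cls_al : forall A, A ∈ power W -> cls A ∈ algebra)
    by (intros A HA; apply Hal; eauto).
  assert (Hord : forall a b, rel order a b <-> a ∈ algebra /\ b ∈ algebra /\
    exists A B, A ∈ power W /\ B ∈ power W /\ a = cls A /\ b = cls B /\ le A B).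
  { intros a b. apply (rel_relation algebra algebra (fun a b => exists A B,
      A ∈ power W /\ B ∈ power W /\ a = cls A /\ b = cls B /\ le A B)). definability. }
  assert (Hle : forall A B, A ∈ power W -> B ∈ power W ->
    (rel order (cls A) (cls B) <-> le A B)).
  { intros A B HA HB. rewrite Hord. split.
    - intros (_ & _ & A' & B' & HA' & HB' & EA & EB & L).
      destruct (cls_eq A A' HA' EA). destruct (cls_eq B B' HB' EB). eauto.
    - intro L. split; [auto|]. split; [auto|]. exists A, B. auto. }
  assert (Pcup : forall A B, A ∈ power W -> B ∈ power W -> cup A B ∈ power W).
  { intros A B. rewrite !in_power. intros HA HB x Hx. apply in_cup in Hx.
    destruct Hx; auto. }
  assert (Pcap : forall A B, A ∈ power W -> cap A B ∈ power W).
  { intros A B. rewrite !in_power. intros HA x Hx. apply in_cap in Hx. apply HA, Hx. }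
  assert (Pdiff : forall A, diff W A ∈ power W).
  { intro A. apply in_power. intros x Hx. apply in_diff in Hx. tauto. }
  assert (PW : W ∈ power W) by (apply in_power; intros x Hx; exact Hx).
  assert (P0 : empty ∈ power W)
    by (apply in_power; intros x Hx; destruct (not_in_empty _ Hx)).
  assert (po : partial_order algebra order).
  { split; [|split].
    - intros a Ha. apply Hal in Ha. destruct Ha as (A & HA & ->).
      apply Hle; auto.
    - intros a b Ha Hb. apply Hal in Ha, Hb.
      destruct Ha as (A & HA & ->), Hb as (B & HB & ->). rewrite !Hle by assumption.
      apply cls_intro.
    - intros a b d Ha Hb Hd. apply Hal in Ha, Hb, Hd.
      destruct Ha as (A & HA & ->), Hb as (B & HB & ->), Hd as (D & HD & ->).
      rewrite !Hle by assumption. apply le_trans. }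
  assert (join : forall A B, A ∈ power W -> B ∈ power W ->
    is_join algebra order (cls A) (cls B) (cls (cup A B))).
  { intros A B HA HB. split; [auto|]. rewrite !Hle by auto.
    split; [apply sub_le; intros x; rewrite in_cup; auto|].
    split; [apply sub_le; intros x; rewrite in_cup; auto|].
    intros d Hd. apply Hal in Hd. destruct Hd as (D & HD & ->). rewrite !Hle by auto.
    intros H K. destruct (le_both _ _ _ _ H K) as (E & HE & L & M).
    exists E. split; [exact HE|]. intros x Hx. rewrite in_cap, in_cup in Hx.
    destruct Hx as [[Hx|Hx] Ex]; [apply L|apply M]; apply in_cap; auto. }
  assert (meet : forall A B, A ∈ power W -> B ∈ power W ->
    is_meet algebra order (cls A) (cls B) (cls (cap A B))).
  { intros A B HA HB. split; [auto|]. rewrite !Hle by auto.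
    split; [apply sub_le; intros x; rewrite in_cap; tauto|].
    split; [apply sub_le; intros x; rewrite in_cap; tauto|].
    intros d Hd. apply Hal in Hd. destruct Hd as (D & HD & ->). rewrite !Hle by auto.
    intros H K. destruct (le_both _ _ _ _ H K) as (E & HE & L & M).
    exists E. split; [exact HE|]. intros x Hx. apply in_cap. auto. }
  assert (joinU : forall a b c c', is_join algebra order a b c ->
    is_join algebra order a b c' -> c = c').
  { intros a b c c' (H1 & H2 & H3 & H4) (K1 & K2 & K3 & K4).
    apply po; auto. }
  assert (meetU : forall a b c c', is_meet algebra order a b c ->
    is_meet algebra order a b c' -> c = c').
  { intros a b c c' (H1 & H2 & H3 & H4) (K1 & K2 & K3 & K4).
    apply po; auto. }
  assert (bot : is_bottom algebra order (cls empty)).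
  { split; [auto|]. intros b Hb. apply Hal in Hb. destruct Hb as (B & HB & ->).
    apply Hle; auto. apply sub_le. intros x Hx. destruct (not_in_empty _ Hx). }
  assert (topW : is_top algebra order (cls W)).
  { split; [auto|]. intros b Hb. apply Hal in Hb. destruct Hb as (B & HB & ->).
    apply Hle; auto. apply sub_le, in_power, HB. }
  assert (ba : boolean_algebra algebra order).
  { split; [exact po|]. split; [|split; [|split]].
    - intros a b Ha Hb. apply Hal in Ha, Hb.
      destruct Ha as (A & HA & ->), Hb as (B & HB & ->). eauto.
    - intros a b Ha Hb. apply Hal in Ha, Hb.
      destruct Ha as (A & HA & ->), Hb as (B & HB & ->). eauto.
    - intros a b c d u v x Ha Hb Hc. apply Hal in Ha, Hb, Hc.
      destruct Ha as (A & HA & ->), Hb as (B & HB & ->), Hc as (D & HD & ->).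
      intros Jd Mx Mu Mv.
      rewrite (joinU _ _ _ _ Jd (join B D HB HD)) in Mx.
      rewrite (meetU _ _ _ _ Mu (meet A B HA HB)).
      rewrite (meetU _ _ _ _ Mv (meet A D HA HD)).
      rewrite (meetU _ _ _ _ Mx (meet A (cup B D) HA (Pcup _ _ HB HD))).
      replace (cap A (cup B D)) with (cup (cap A B) (cap A D)); [auto|].
      apply set_ext. intro y. rewrite in_cup, !in_cap, in_cup. tauto.
    - exists (cls empty), (cls W). split; [exact bot|]. split; [exact topW|]. split.
      (* The algebra is nondegenerate: identifying W with ∅ would put some member of C inside ∅. *)
      + intro E. destruct (cls_eq _ _ PW E) as [_ (F & HF & K)].
        destruct (Cne F HF) as [s Hs]. apply (not_in_empty s), K, in_cap.
        split; [exact (CW F HF s Hs)|exact Hs].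
      + intros a Ha. apply Hal in Ha. destruct Ha as (A & HA & ->).
        exists (cls (diff W A)). split; [auto|].
        pose proof (join A (diff W A) HA (Pdiff A)) as J.
        pose proof (meet A (diff W A) HA (Pdiff A)) as M. apply in_power in HA.
        replace (cup A (diff W A)) with W in J.
        * replace (cap A (diff W A)) with empty in M; [auto|].
          apply set_ext. intro x. rewrite in_cap, in_diff.
          pose proof (not_in_empty x). tauto.
        * apply set_ext. intro x. rewrite in_cup, in_diff. specialize (HA x).
          destruct (classic (x ∈ A)); tauto. }
  destruct (bpi algebra order ba) as (I & IB & I0 & I1 & Idown & Ijoin & Iprime).
  set (U := sep (power W) (fun A => cls A ∉ I)).
  assert (HU : forall A, A ∈ U <-> A ∈ power W /\ cls A ∉ I)
    by (intro; refine (in_sep _ _ _ _); definability).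
  exists U. split; [|split; [|split; [|split]]].
  - intros E HE. apply HU. split; [apply in_power; auto|].
    replace (cls E) with (cls W); [auto|]. apply cls_intro.
    + exists E. split; [exact HE|]. intros x Hx. apply in_cap in Hx. tauto.
    + apply sub_le. auto.
  - rewrite HU. intros [_ K]. auto.
  - intros A B HA AB BW. apply HU in HA. destruct HA as [HA K]. apply HU.
    apply in_power in BW. split; [exact BW|]. intro L. apply K.
    apply (Idown (cls B)); auto. apply Hle; auto.
  - intros A B HA HB. apply HU in HA, HB. apply HU. split; [apply Pcap; tauto|].
    intro L. destruct HA as [HA KA], HB as [HB KB].
    destruct (Iprime (cls A) (cls B) (cls (cap A B))); auto.
  - intros A B AW BW K. apply NNPP. intro N. apply HU in K. apply (proj2 K).
    apply in_power in AW, BW. apply (Ijoin (cls A) (cls B)); auto;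
      apply NNPP; intro L; apply N; rewrite !HU; auto.
Qed.

End Ultrafilter.

(** * Discrete subspaces converging to a point *)

Lemma is_inter_iff C A B : is_inter C A B <-> C = cap A B.
Proof.
  split.
  - intro H. apply set_ext. intro x. rewrite (H x), in_cap. tauto.
  - intros -> x. apply in_cap.
Qed.

Lemma is_diff_iff C A B : is_diff C A B <-> C = diff A B.
Proof.
  split.
  - intro H. apply set_ext. intro x. rewrite (H x), in_diff. tauto.
  - intros -> x. apply in_diff.
Qed.

Lemma is_union_iff C A : is_union C A <-> C = bigcup A.
Proof.
  split.
  - intro H. apply set_ext. intro x. rewrite (H x), in_bigcup. tauto.
  - intros -> x. apply in_bigcup.
Qed.

(** Covering sets are picked one point at a time along the induction, so that no choice is
    involved. *)
Lemma finite_subcover C K : finite K -> covers C K ->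
  exists B, subset B C /\ finite B /\ covers B K.
Proof.
  revert K. refine (finite_ind _ _ _ _); [unfold covers; definability| |].
  - intros _. exists empty.
    split; [intros x Hx; destruct (not_in_empty _ Hx)|].
    split; [exact finite_empty|]. intros x Hx; destruct (not_in_empty _ Hx).
  - intros K a _ _ IH H. destruct IH as (B & HB & FB & cB).
    { intros x Hx. apply H, in_cup. auto. }
    destruct (H a) as (U & HU & Ha); [rewrite in_cup, in_sing; auto|].
    exists (cup B (sing U)).
    split; [intros x Hx; rewrite in_cup, in_sing in Hx; destruct Hx; subst; auto|].
    split; [exact (finite_add _ _ FB)|]. intros x Hx.
    rewrite in_cup, in_sing in Hx. destruct Hx as [Hx| ->].
    + destruct (cB x Hx) as (W & HW & K'). exists W. rewrite in_cup. auto.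
    + exists U. rewrite in_cup, in_sing. auto.
Qed.

(** A finite subcover of the cover of K by singletons shows that K is finite. *)
Lemma compact_discrete_iff E K :
  compact_subset E (power E) K <-> subset K E /\ finite K.
Proof.
  split.
  - intros [HK (S & HS & C)]. split; [exact HK|].
    destruct (C (image K sing)) as (F & HF & fF & cF).
    + intros U HU. apply in_image in HU; [|definability].
      destruct HU as (x & Hx & ->). apply HS. exists (sing x).
      rewrite in_power, is_inter_iff. split.
      * intros y Hy. apply in_sing in Hy. subst. auto.
      * apply set_ext. intro y. rewrite in_cap, in_sing.
        split; [intros ->; auto|tauto].
    + intros x Hx. exists (sing x). rewrite in_sing, in_image by definability. eauto.
    + apply (finite_subset (bigcup F)).
      * apply finite_bigcup; [exact fF|]. intros U HU. apply HF in HU.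
        apply in_image in HU; [|definability]. destruct HU as (x & _ & ->).
        apply finite_sing.
      * intros x Hx. apply in_bigcup. destruct (cF x Hx) as (U & HU & K'). eauto.
  - intros [HK fK]. split; [exact HK|]. exists (power K). split.
    + intro U. rewrite in_power. split.
      * intro HU. exists U. rewrite in_power, is_inter_iff. split.
        -- intros y Hy. auto.
        -- apply set_ext. intro y. rewrite in_cap. split; [auto|tauto].
      * intros (O & _ & HO). apply is_inter_iff in HO. subst U.
        intros y Hy. apply in_cap in Hy. tauto.
    + intros C _ H. exact (finite_subcover C K fK H).
Qed.

(** Convergence of a set without enumeration; for the range of a sequence of distinct points it is
    the usual notion. *)
Definition converges T D x : Prop :=
  forall U, U ∈ T -> x ∈ U -> finite (diff D U).

(** * Open sets in a Hausdorff space *)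

Section CompactSpace.
Context (X T : V) (top : topology X T) (haus : hausdorff X T).

Lemma open_subset U : U ∈ T -> subset U X.
Proof. apply top. Qed.

Lemma open_space : X ∈ T.
Proof. apply top. Qed.

Lemma open_empty : empty ∈ T.
Proof. apply top. apply is_empty_iff. reflexivity. Qed.

Lemma open_cap U W : U ∈ T -> W ∈ T -> cap U W ∈ T.
Proof.
  intros HU HW. destruct top as (_ & _ & _ & H & _). apply (H U W); auto.
  apply is_inter_iff. reflexivity.
Qed.

Lemma open_bigcup C : subset C T -> bigcup C ∈ T.
Proof.
  intros HC. destruct top as (_ & _ & _ & _ & H). apply (H C); auto.
  apply is_union_iff. reflexivity.
Qed.

Lemma open_finite_cap C : finite C -> subset C T ->
  sep X (fun y => forall U, U ∈ C -> y ∈ U) ∈ T.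
Proof.
  assert (H : forall C y, y ∈ sep X (fun y => forall U, U ∈ C -> y ∈ U) <->
    y ∈ X /\ forall U, U ∈ C -> y ∈ U)
    by (intros C0 y; apply (in_sep (fun y => forall U, U ∈ C0 -> y ∈ U)); definability).
  revert C. refine (finite_ind _ _ _ _); [definability| |].
  - intros _. replace (sep X (fun y => forall U, U ∈ empty -> y ∈ U)) with X;
      [exact open_space|].
    apply set_ext. intro y. rewrite H. split; [|tauto]. intro Hy.
    split; [exact Hy|]. intros U HU. destruct (not_in_empty _ HU).
  - intros C W _ _ IH HC.
    replace (sep X (fun y => forall U, U ∈ cup C (sing W) -> y ∈ U))
      with (cap (sep X (fun y => forall U, U ∈ C -> y ∈ U)) W).
    + apply open_cap; [apply IH|apply HC; rewrite in_cup, in_sing; auto].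
      intros U HU. apply HC, in_cup. auto.
    + apply set_ext. intro y. rewrite in_cap, !H. split.
      * intros [[Hy K] L]. split; [exact Hy|]. intros U HU.
        rewrite in_cup, in_sing in HU. destruct HU; subst; auto.
      * intros [Hy K]. split; [split; [exact Hy|]|];
          intros; apply K; rewrite in_cup, in_sing; auto.
Qed.

(** The union of all open sets that miss a; taking all of them avoids choosing a neighbourhood for
    each point. *)
Lemma open_remove_point a : a ∈ X -> diff X (sing a) ∈ T.
Proof.
  intro Ha. replace (diff X (sing a)) with (bigcup (sep T (fun O => a ∉ O))).
  - apply open_bigcup. intros O HO. rewrite in_sep in HO by definability. tauto.
  - apply set_ext. intro y. rewrite in_bigcup, in_diff, in_sing. split.
    + intros (O & HO & Hy). rewrite in_sep in HO by definability.
      destruct HO as [HO K]. split; [exact (open_subset O HO y Hy)|].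
      intros ->. exact (K Hy).
    + intros [Hy Hne]. destruct (haus y a Hy Ha Hne) as (U & W & HU & HW & K & L & N).
      exists U. rewrite in_sep by definability.
      split; [split; [exact HU|intro aU; apply N; eauto]|exact K].
Qed.

Lemma open_remove_finite U F : U ∈ T -> finite F -> subset F X -> diff U F ∈ T.
Proof.
  intros HU. revert F. refine (finite_ind _ _ _ _); [definability| |].
  - intros _. replace (diff U empty) with U; [exact HU|]. apply set_ext. intro x.
    rewrite in_diff. pose proof (not_in_empty x). tauto.
  - intros F a _ _ IH H.
    replace (diff U (cup F (sing a))) with (cap (diff U F) (diff X (sing a))).
    + apply open_cap.
      * apply IH. intros x Hx. apply H, in_cup. auto.
      * apply open_remove_point, H. rewrite in_cup, in_sing. auto.
    + apply set_ext. intro x. rewrite in_cap, !in_diff, in_cup, in_sing.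
      pose proof (open_subset U HU x). tauto.
Qed.

(** * Convergent sets give copies of one-point compactifications *)

Section Copy.
Context (D x : V) (DX : subset D X) (xX : x ∈ X) (xD : x ∉ D)
  (conv : converges T D x).

Let Z := cup D (sing x).

Let in_Z z : z ∈ Z <-> z ∈ D \/ z = x.
Proof. unfold Z. rewrite in_cup, in_sing. tauto. Qed.

Let ZX z : z ∈ Z -> z ∈ X.
Proof. intro H. apply in_Z in H. destruct H; subst; auto. Qed.

(** Separate d from x by U and W. Only finitely many points of D lie outside W; once those other
    than d are removed from U, the only point of [Z] left in it is d. *)
Lemma isolated_point d : d ∈ D ->
  exists O, O ∈ T /\ forall z, z ∈ Z -> (z ∈ O <-> z = d).
Proof.
  intro Hd.
  assert (Hne : d <> x) by (intros ->; exact (xD Hd)).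
  destruct (haus d x (DX d Hd) xX Hne) as (U & W & HU & HW & dU & xW & N).
  set (F := diff (diff D W) (sing d)).
  assert (HF : forall z, z ∈ F <-> (z ∈ D /\ z ∉ W) /\ z <> d)
    by (intro; unfold F; rewrite !in_diff, in_sing; tauto).
  exists (diff U F). split.
  - apply open_remove_finite; [exact HU| |].
    + apply (finite_subset _ _ (conv W HW xW)). intros z Hz. apply in_diff in Hz. tauto.
    + intros z Hz. apply HF in Hz. apply DX. tauto.
  - intros z Hz. rewrite in_diff, HF. split.
    + intros [zU K]. apply NNPP. intro L. apply K. split; [|exact L].
      assert (zW : z ∉ W) by (intro; apply N; eauto). split; [|exact zW].
      apply in_Z in Hz. destruct Hz as [Hz| ->]; [exact Hz|]. destruct (zW xW).
    + intros ->. tauto.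
Qed.

Lemma open_in_discrete_part U : subset U D ->
  exists O, O ∈ T /\ forall z, z ∈ Z -> (z ∈ O <-> z ∈ U).
Proof.
  intro HU. set (C := sep T (fun O => forall z, z ∈ Z -> z ∈ O -> z ∈ U)).
  assert (HC : forall O, O ∈ C <-> O ∈ T /\ forall z, z ∈ Z -> z ∈ O -> z ∈ U)
    by (intro; refine (in_sep _ _ _ _); definability).
  exists (bigcup C). split; [apply open_bigcup; intros O HO; apply HC in HO; tauto|].
  intros z Hz. rewrite in_bigcup. split.
  - intros (O & HO & K). apply HC in HO. destruct HO as [_ HO]. auto.
  - intro zU. destruct (isolated_point z (HU z zU)) as (O & HO & K).
    exists O. split; [|apply K; auto]. apply HC. split; [exact HO|].
    intros y Hy yO. apply K in yO; [|exact Hy]. subst. exact zU.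
Qed.

Lemma open_at_limit U : x ∈ U -> finite (diff Z U) ->
  exists O, O ∈ T /\ forall z, z ∈ Z -> (z ∈ O <-> z ∈ U).
Proof.
  intros xU F. exists (diff X (diff Z U)). split.
  - apply open_remove_finite; [exact open_space|exact F|].
    intros z Hz. apply in_diff in Hz. apply ZX, Hz.
  - intros z Hz. rewrite !in_diff. pose proof (ZX z Hz).
    destruct (classic (z ∈ U)); tauto.
Qed.

(** The bijection h from E onto D is extended by sending the point at infinity to x; both directions
    are continuous because D converges to x. *)
Lemma alexandroff_copy E (h : V -> V) : dfun1 h ->
  (forall y, y ∈ E -> h y ∈ D) ->
  (forall y y', y ∈ E -> y' ∈ E -> h y = h y' -> y = y') ->
  (forall d, d ∈ D -> exists y, y ∈ E /\ h y = d) ->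
  contains_alexandroff_of_discrete X T E.
Proof.
  intros Dh hD I sur.
  (* The set E itself serves as the point at infinity, as E ∉ E. *)
  set (Y := succ E). assert (HY : forall y, y ∈ Y <-> y ∈ E \/ y = E)
    by (intro; apply in_succ).
  assert (EE : E ∉ E) by apply not_mem_self.
  set (S := sep (power Y) (fun U => E ∈ U -> finite (diff Y U))).
  assert (HS : forall U, U ∈ S <-> subset U Y /\ (E ∈ U -> finite (diff Y U)))
    by (intro U; rewrite <- in_power; refine (in_sep _ _ _ _); definability).
  set (TZ := image T (fun O => cap O Z)).
  assert (HTZ : forall U, U ∈ TZ <-> exists O, O ∈ T /\ U = cap O Z)
    by (intro; refine (in_image _ _ _ _); definability).
  set (Q := fun y z => (y ∈ E /\ z = h y) \/ (y = E /\ z = x)).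
  assert (DQ : definable2 Q) by (unfold Q; definability).
  assert (DQ' : definable2 (fun z y => Q y z)) by (unfold Q; definability).
  assert (Q1 : forall y, y ∈ Y -> exists z, z ∈ Z /\ Q y z).
  { intros y Hy. apply HY in Hy. destruct Hy as [Hy| ->].
    - exists (h y). rewrite in_Z. unfold Q. auto.
    - exists x. rewrite in_Z. unfold Q. auto. }
  assert (Q2 : forall y z z', Q y z -> Q y z' -> z = z').
  { intros y z z' [[H ->]|[-> ->]] [[K ->]|[K ->]]; subst; tauto. }
  assert (Q3 : forall y y' z, Q y z -> Q y' z -> y = y').
  { intros y y' z [[H L]|[H L]] [[H' L']|[H' L']].
    - apply I; congruence.
    - destruct xD. rewrite <- L', L. auto.
    - destruct xD. rewrite <- L, L'. auto.
    - congruence. }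
  assert (Q4 : forall z, z ∈ Z -> exists y, y ∈ Y /\ Q y z).
  { intros z Hz. apply in_Z in Hz. destruct Hz as [Hz| ->].
    - destruct (sur z Hz) as (y & Hy & <-). exists y. rewrite HY. unfold Q. auto.
    - exists E. rewrite HY. unfold Q. auto. }
  set (f := relation Z Y (fun z y => Q y z)). set (g := relation Y Z Q).
  assert (Hf : forall z y, rel f z y <-> z ∈ Z /\ y ∈ Y /\ Q y z)
    by (intros; apply (rel_relation Z Y (fun z y => Q y z)); exact DQ').
  assert (Hg : forall y z, rel g y z <-> y ∈ Y /\ z ∈ Z /\ Q y z)
    by (intros; apply rel_relation; exact DQ).
  assert (inf : is_injection f Z Y)
    by (apply relation_is_injection; [exact DQ'|exact Q4|eauto|eauto]).
  assert (ing : is_injection g Y Z)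
    by (apply relation_is_injection; [exact DQ|exact Q1|eauto|eauto]).
  exists (power E), Y, S. split; [intro; apply in_power|]. split.
  - exists E. split; [exact EE|]. split; [exact HY|]. intro U. rewrite HS, in_power.
    split.
    + intros [HU fU]. destruct (classic (E ∈ U)) as [K|K].
      * right. split; [exact HU|]. split; [exact K|]. exists (diff Y U).
        assert (sub : subset (diff Y U) E).
        { intros y Hy. apply in_diff in Hy. destruct Hy as [Hy L].
          apply HY in Hy. destruct Hy; subst; tauto. }
        rewrite is_diff_iff. split; [reflexivity|]. split.
        -- split; [exact sub|]. exists (diff E (diff Y U)). rewrite is_diff_iff.
           split; [reflexivity|]. apply in_power. intros y Hy.
           apply in_diff in Hy. tauto.
        -- apply compact_discrete_iff. auto.
      * left. intros y Hy. pose proof (HU y Hy) as L. apply HY in L.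
        destruct L; subst; tauto.
    + intros [HU|(HU & K & C & HC & _ & comp)].
      * split; [intros y Hy; apply HY; auto|]. intro K. destruct (EE (HU E K)).
      * split; [exact HU|]. intros _. apply is_diff_iff in HC. subst C.
        apply compact_discrete_iff in comp. tauto.
  - exists Z, TZ. split; [exact ZX|]. split.
    { intro U. rewrite HTZ. split; intros (O & HO & K); exists O;
        apply is_inter_iff in K || rewrite is_inter_iff; auto. }
    assert (TZ_intro : forall U, subset U Z ->
      (exists O, O ∈ T /\ forall z, z ∈ Z -> (z ∈ O <-> z ∈ U)) -> U ∈ TZ).
    { intros U HU (O & HO & K). apply HTZ. exists O. split; [exact HO|].
      apply set_ext. intro z. rewrite in_cap. split.
      - intro zU. split; [apply K; auto|auto].
      - intros [zO zZ]. apply K; auto. }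
    exists f, g. split; [|split].
    + split; [exact (proj1 inf)|]. intros W HW. apply HS in HW. destruct HW as [HW fW].
      set (U := sep Z (fun z => exists y, y ∈ W /\ rel f z y)).
      assert (HU : forall z, z ∈ U <-> z ∈ Z /\ exists y, y ∈ W /\ rel f z y)
        by (intro; refine (in_sep _ _ _ _); definability).
      exists U. split; [|exact HU].
      apply TZ_intro; [intros z Hz; apply HU in Hz; tauto|].
      assert (xE : rel f x E) by (rewrite Hf, in_Z, HY; unfold Q; auto).
      (* If W contains the point at infinity, the complement of its preimage injects into the finite
         complement of W. Otherwise the preimage lies in D, all of whose subsets are traces of open
         sets. *)
      destruct (classic (E ∈ W)) as [K|K].
      * apply open_at_limit.
        -- apply HU. rewrite in_Z. split; [auto|]. exists E. auto.
        -- destruct (injection_app _ _ _ inf) as [_ J].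
           apply (finite_of_injective _ (diff Y W) (app f)); [definability| | |auto].
           ++ intros z Hz. apply in_diff in Hz. destruct Hz as [Hz L].
              destruct (app_in _ _ _ _ (proj1 inf) Hz) as [M R].
              apply in_diff. split; [exact M|]. intro N. apply L, HU. eauto.
           ++ intros z z' Hz Hz'. apply in_diff in Hz, Hz'. apply J; tauto.
      * apply open_in_discrete_part. intros z Hz. apply HU in Hz.
        destruct Hz as [Hz (y & Hy & R)]. apply in_Z in Hz.
        destruct Hz as [Hz| ->]; [exact Hz|].
        rewrite (function_unique _ _ _ _ _ _ (proj1 inf) R xE) in Hy. tauto.
    + split; [exact (proj1 ing)|]. intros W HW. apply HTZ in HW.
      destruct HW as (O & HO & ->).
      set (U := sep Y (fun y => exists z, z ∈ cap O Z /\ rel g y z)).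
      assert (HU : forall y, y ∈ U <-> y ∈ Y /\ exists z, z ∈ cap O Z /\ rel g y z)
        by (intro; refine (in_sep _ _ _ _); definability).
      exists U. split; [|exact HU]. apply HS.
      split; [intros y Hy; apply HU in Hy; tauto|]. intro EU.
      assert (gE : rel g E x) by (rewrite Hg, in_Z, HY; unfold Q; auto).
      assert (xO : x ∈ O).
      { apply HU in EU. destruct EU as [_ (z & Hz & R)].
        rewrite (function_unique _ _ _ _ _ _ (proj1 ing) R gE) in Hz.
        apply in_cap in Hz. tauto. }
      (* Points outside the preimage go injectively to points of D outside [O], which are finitely
         many by convergence. *)
      destruct (injection_app _ _ _ ing) as [_ J].
      apply (finite_of_injective _ (diff D O) (app g)); [definability| | |auto].
      * intros y Hy. apply in_diff in Hy. destruct Hy as [Hy L].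
        destruct (app_in _ _ _ _ (proj1 ing) Hy) as [M R].
        assert (N : app g y ∉ O).
        { intro N. apply L, HU. split; [exact Hy|]. exists (app g y).
          rewrite in_cap. auto. }
        apply in_diff. split; [|exact N]. apply in_Z in M.
        destruct M as [M|M]; [exact M|]. rewrite M in N. destruct (N xO).
      * intros y y' Hy Hy'. apply in_diff in Hy, Hy'. apply J; tauto.
    + intros z y. rewrite Hf, Hg. tauto.
Qed.

End Copy.

(** * Decreasing bases and accumulation points *)

(** [B n] is the intersection of the members of the given base numbered below n, finitely many
    because the numbering is injective. *)
Lemma decreasing_base x : first_countable X T -> x ∈ X ->
  exists B : V -> V, dfun1 B /\
    (forall n, n ∈ omega -> B n ∈ T /\ x ∈ B n) /\
    (forall n m, m ∈ omega -> n ∈ m -> subset (B m) (B n)) /\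
    (forall U, U ∈ T -> x ∈ U -> exists n, n ∈ omega /\ subset (B n) U).
Proof.
  intros fc Hx. destruct (fc x Hx) as (C & HC & C1 & C2).
  apply countable_iff in HC. destruct HC as (g & Dg & Hg & I).
  set (K := fun n => sep C (fun U => g U ∈ n)).
  assert (HK : forall n U, U ∈ K n <-> U ∈ C /\ g U ∈ n)
    by (intros n U; apply (in_sep (fun U => g U ∈ n)); definability).
  set (B := fun n => sep X (fun y => forall U, U ∈ K n -> y ∈ U)).
  assert (HB : forall n y, y ∈ B n <-> y ∈ X /\ forall U, U ∈ K n -> y ∈ U)
    by (intros n y; apply (in_sep (fun y => forall U, U ∈ K n -> y ∈ U)); definability).
  exists B. split; [unfold B, K; definability|]. split; [|split].
  - intros n Hn. split.
    + apply open_finite_cap.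
      * apply (finite_of_injective _ n g Dg); [| |exact (finite_nat n Hn)].
        -- intros U HU. apply HK in HU. tauto.
        -- intros U U' HU HU'. apply HK in HU, HU'. apply I; tauto.
      * intros U HU. apply HK in HU. apply C1, HU.
    + apply HB. split; [exact Hx|]. intros U HU. apply HK in HU. apply C1, HU.
  - intros n m Hm Hnm y. rewrite !HB. intros [Hy L]. split; [exact Hy|].
    intros U HU. apply L. rewrite HK in *. split; [tauto|].
    apply (omega_trans m n _ Hm Hnm). tauto.
  - intros U HU xU. destruct (C2 U HU xU) as (W & HW & WU).
    (* The successor is needed for W itself to be among the sets intersected. *)
    exists (succ (g W)). split; [auto using succ_in_omega|]. intros y Hy.
    apply WU. apply HB in Hy. apply Hy, HK. split; [exact HW|].
    apply in_succ. auto.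
Qed.

(** Otherwise the open sets with finite trace on A would cover X, and a finite subcover would make A
    finite. *)
Lemma accumulation_point A : compact X T -> subset A X -> infinite A ->
  exists x, x ∈ X /\ forall U, U ∈ T -> x ∈ U -> infinite (cap A U).
Proof.
  intros comp HA inf. apply NNPP. intro N. apply inf.
  set (C := sep T (fun U => finite (cap A U))).
  assert (HC : forall U, U ∈ C <-> U ∈ T /\ finite (cap A U))
    by (intro; refine (in_sep _ _ _ _); definability).
  destruct (comp C) as (F & FC & fF & cF).
  - intros U HU. apply HC, HU.
  - intros x Hx. apply NNPP. intro K. apply N. exists x. split; [exact Hx|].
    intros U HU xU fU. apply K. exists U. rewrite HC. auto.
  - assert (DF : dfun1 (fun U => cap A U)) by definability.
    apply (finite_subset (bigcup (image F (fun U => cap A U)))).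
    + apply finite_bigcup; [exact (finite_image _ _ DF fF)|]. intros B HB.
      apply in_image in HB; [|exact DF]. destruct HB as (U & HU & ->).
      apply FC, HC in HU. tauto.
    + intros a Ha. destruct (cF a (HA a Ha)) as (U & HU & aU).
      apply in_bigcup. exists (cap A U). rewrite in_cap, in_image by exact DF. eauto.
Qed.

Lemma infinite_other A x : infinite A -> exists a, a ∈ A /\ a <> x.
Proof.
  intro H. apply NNPP. intro K. apply H. apply (finite_subset _ _ (finite_sing x)).
  intros a Ha. apply in_sing. apply NNPP. eauto.
Qed.

(** * Copies from infinite cuf and countable subsets *)

Context (comp : compact X T) (fc : first_countable X T).

(** [D] collects, for every [n], the points of the [n]-th neighbourhood of [x]
    lying in the first of the given finite sets that meets it outside [x]. *)
Lemma convergent_subset A : subset A X -> infinite A -> cuf A ->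
  exists D x, subset D A /\ x ∈ X /\ x ∉ D /\ infinite D /\ converges T D x.
Proof.
  intros AX inf (C & HC & fC & HA). apply is_union_iff in HA.
  apply countable_iff in HC. destruct HC as (g & Dg & Hg & I).
  destruct (accumulation_point A comp AX inf) as (x & Hx & acc).
  destruct (decreasing_base x fc Hx) as (B & DB & B1 & B2 & B3).
  set (M := fun n => sep C (fun F => exists y, y ∈ F /\ y ∈ B n /\ y <> x)).
  assert (HM : forall n F, F ∈ M n <-> F ∈ C /\ exists y, y ∈ F /\ y ∈ B n /\ y <> x)
    by (intros n F; apply (in_sep (fun F => exists y, y ∈ F /\ y ∈ B n /\ y <> x));
        definability).
  assert (DM : dfun1 M) by (unfold M; definability).
  (* The number of the first finite set that meets [B n] outside x. *)
  set (l := fun n => least (image (M n) g)).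
  assert (Dl : dfun1 l) by (unfold l; definability).
  assert (Hl : forall n, n ∈ omega -> exists F, F ∈ M n /\ g F = l n).
  { intros n Hn. assert (L : l n ∈ image (M n) g).
    { apply least_spec.
      - intros k Hk. apply in_image in Hk; [|exact Dg]. destruct Hk as (F & HF & ->).
        apply HM in HF. apply Hg, HF.
      - destruct (B1 n Hn) as [On xn].
        destruct (infinite_other _ x (acc (B n) On xn)) as (a & Ha & ax).
        apply in_cap in Ha. destruct Ha as [Ha an]. rewrite HA in Ha.
        apply in_bigcup in Ha. destruct Ha as (F & HF & aF). exists (g F).
        apply in_image; [exact Dg|]. exists F. rewrite HM. eauto 7. }
    apply in_image in L; [|exact Dg]. destruct L as (F & HF & E). eauto. }
  set (D := sep A (fun a => a <> x /\ exists n, n ∈ omega /\ a ∈ B n /\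
    exists F, F ∈ C /\ a ∈ F /\ g F = l n)).
  assert (HD : forall a, a ∈ D <-> a ∈ A /\ a <> x /\ exists n, n ∈ omega /\
    a ∈ B n /\ exists F, F ∈ C /\ a ∈ F /\ g F = l n)
    by (intro; refine (in_sep _ _ _ _); definability).
  assert (DA : subset D A) by (intros a Ha; apply HD in Ha; tauto).
  assert (xD : x ∉ D) by (rewrite HD; tauto).
  exists D, x. split; [exact DA|]. split; [exact Hx|]. split; [exact xD|]. split.
  (* If D were finite, some [B n] would avoid D. But the finite set selected for n has a point in
     [B n] other than x, and that point is in D. *)
  - intro fD. destruct (B3 (diff X D)) as (n & Hn & L).
    + apply open_remove_finite; [exact open_space|exact fD|]. intros a Ha; auto.
    + apply in_diff. auto.
    + destruct (Hl n Hn) as (F & HF & E). apply HM in HF.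
      destruct HF as [HF (y & yF & yB & yx)].
      pose proof (L y yB) as K. apply in_diff in K. apply (proj2 K).
      apply HD. split; [rewrite HA; apply in_bigcup; eauto|].
      split; [exact yx|]. exists n. eauto 7.
  - intros U HU xU. destruct (B3 U HU xU) as (m & Hm & BU).
    (* The finite sets selected before stage m. A point collected at stage m or later lies in [B m],
       hence in U, so the points of D outside U are covered by [G]. *)
    set (G := sep C (fun F => exists n, n ∈ m /\ g F = l n)).
    assert (HG : forall F, F ∈ G <-> F ∈ C /\ exists n, n ∈ m /\ g F = l n)
      by (intro; refine (in_sep _ _ _ _); definability).
    apply (finite_subset (bigcup G)).
    + apply finite_bigcup; [|intros F HF; apply HG in HF; apply fC, HF].
      apply (finite_of_injective _ (image m l) g Dg).
      * intros F HF. apply HG in HF. destruct HF as [_ (n & Hn & ->)].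
        apply in_image; eauto.
      * intros F F' HF HF'. apply HG in HF, HF'. apply I; tauto.
      * apply finite_image; [exact Dl|exact (finite_nat m Hm)].
    + intros a Ha. apply in_diff in Ha. destruct Ha as [Ha aU]. apply HD in Ha.
      destruct Ha as (_ & _ & n & Hn & aB & F & HF & aF & E).
      apply in_bigcup. exists F. split; [|exact aF]. apply HG. split; [exact HF|].
      exists n. split; [|exact E].
      destruct (omega_linear n m Hn Hm) as [L|[L|L]]; [exact L| |].
      * subst n. destruct (aU (BU a aB)).
      * destruct (aU (BU a (B2 m n Hn L a aB))).
Qed.

(** The convergent subset D is again cuf, as the union of the traces on D of the finite sets that
    make up A. *)
Lemma contains_cuf_of_infinite_cuf A : subset A X -> infinite A -> cuf A ->
  contains_alexandroff_of_infinite_discrete_cuf X T.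
Proof.
  intros AX inf HA.
  destruct (convergent_subset A AX inf HA) as (D & x & DA & Hx & xD & infD & conv).
  exists D. split; [exact infD|]. split.
  - destruct HA as (C & HC & fC & E). apply is_union_iff in E.
    assert (DF : dfun1 (fun F => cap F D)) by definability.
    exists (image C (fun F => cap F D)).
    split; [exact (countable_image _ _ DF HC)|]. split.
    + intros F HF. apply in_image in HF; [|exact DF]. destruct HF as (F' & HF' & ->).
      apply (finite_subset _ _ (fC F' HF')). intros y Hy. apply in_cap in Hy. tauto.
    + apply is_union_iff, set_ext. intro y. rewrite in_bigcup. split.
      * intro Hy. pose proof (DA y Hy) as K. rewrite E in K. apply in_bigcup in K.
        destruct K as (F & HF & yF). exists (cap F D).
        rewrite in_cap, in_image by exact DF. eauto.
      * intros (F & HF & yF). apply in_image in HF; [|exact DF].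
        destruct HF as (F' & _ & ->). apply in_cap in yF. tauto.
  - apply (alexandroff_copy D x) with (h := fun y => y); auto.
    + intros d Hd; auto.
    + definability.
    + eauto.
Qed.

(** A countable set is cuf through its singletons. The convergent subset is then countable and
    infinite, so it contains a sequence of distinct points, and convergence passes to subsets. *)
Lemma contains_N_of_countable A : subset A X -> infinite A -> countable A ->
  contains_alexandroff_of_N X T.
Proof.
  intros AX inf HA.
  destruct (convergent_subset A AX inf) as (D & x & DA & Hx & xD & infD & conv).
  { exists (image A sing). split; [apply countable_image; [definability|exact HA]|].
    split.
    - intros F HF. apply in_image in HF; [|definability]. destruct HF as (y & _ & ->).
      apply finite_sing.
    - apply is_union_iff, set_ext. intro y. rewrite in_bigcup. split.
      + intro Hy. exists (sing y). rewrite in_sing, in_image by definability. eauto.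
      + intros (F & HF & yF). apply in_image in HF; [|definability].
        destruct HF as (z & Hz & ->). apply in_sing in yF. subst. exact Hz. }
  destruct (countable_infinite_omega D (countable_subset _ _ HA DA) infD)
    as (F & DF & HF & I).
  assert (sub : subset (image omega F) D).
  { intros y Hy. apply in_image in Hy; [|exact DF]. destruct Hy as (n & Hn & ->). auto. }
  exists omega. split; [exact is_omega_omega|].
  apply (alexandroff_copy (image omega F) x) with (h := F); auto.
  - intros y Hy; auto.
  - intros U HU xU. apply (finite_subset _ _ (conv U HU xU)). intros y Hy.
    rewrite in_diff in *. split; [apply sub|]; tauto.
  - intros n Hn. apply in_image; eauto.
  - intros d Hd. apply in_image in Hd; [|exact DF]. destruct Hd as (n & Hn & ->). eauto.
Qed.

Lemma contains_N_of_sequence (F : V -> V) : dfun1 F ->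
  (forall n, n ∈ omega -> F n ∈ X) ->
  (forall n m, n ∈ omega -> m ∈ omega -> F n = F m -> n = m) ->
  contains_alexandroff_of_N X T.
Proof.
  intros DF FX I. apply (contains_N_of_countable (image omega F)).
  - intros y Hy. apply in_image in Hy; [|exact DF]. destruct Hy as (n & Hn & ->). auto.
  - apply (infinite_of_injective _ F DF); [|exact I].
    intros n Hn. apply in_image; eauto.
  - exact (countable_image _ _ DF countable_omega).
Qed.

(** * Infinite subsets from the weak choice principles and from separability *)

Lemma no_amorphous_subset A : subset A X -> ~ amorphous A.
Proof.
  intros AX [inf am].
  destruct (accumulation_point A comp AX inf) as (x & Hx & acc).
  destruct (decreasing_base x fc Hx) as (B & DB & B1 & B2 & B3).
  set (A' := diff A (sing x)).
  assert (HA' : forall a, a ∈ A' <-> a ∈ A /\ a <> x)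
    by (intro; unfold A'; rewrite in_diff, in_sing; tauto).
  set (N := fun a => sep omega (fun n => a ∉ B n)).
  assert (HN : forall a n, n ∈ N a <-> n ∈ omega /\ a ∉ B n)
    by (intros a n; apply (in_sep (fun n => a ∉ B n)); definability).
  assert (DN : dfun1 N) by (unfold N; definability).
  assert (L : forall a, a ∈ A' -> least (N a) ∈ N a).
  { intros a Ha. apply HA' in Ha. destruct Ha as [Ha ax]. apply least_spec.
    - intros n Hn. apply HN in Hn. tauto.
    - destruct (B3 (diff X (sing a))) as (n & Hn & K).
      + apply open_remove_point; auto.
      + rewrite in_diff, in_sing. auto.
      + exists n. apply HN. split; [exact Hn|]. intro aB.
        specialize (K a aB). rewrite in_diff, in_sing in K. tauto. }
  destruct (finite_to_one_split A' (fun a => least (N a))) as (C & CA & IC & ID).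
  - apply infinite_diff; [exact inf|apply finite_sing].
  - definability.
  - intros a Ha. specialize (L a Ha). apply HN in L. tauto.
  (* Points mapped below n lie outside [B n]. Since [cap A (B n)] is infinite, amorphousness makes
     the rest of A finite. *)
  - intros n Hn. destruct (B1 n Hn) as [On xn].
    destruct (am (cap A (B n))) as (F & HF & fF).
    + intros a Ha. apply in_cap in Ha. tauto.
    + auto.
    + apply is_diff_iff in HF. subst F. apply (finite_subset _ _ fF). intros a Ha.
      rewrite in_sep in Ha by definability. destruct Ha as [Ha K].
      rewrite in_diff, in_cap. split; [apply HA', Ha|]. intros [_ aB].
      specialize (L a Ha). apply HN in L. apply (proj2 L).
      exact (B2 _ n Hn K a aB).
  - destruct (am C) as (F & HF & fF); [|exact IC|].
    + intros a Ha. apply HA', CA, Ha.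
    + apply is_diff_iff in HF. subst F. apply ID, (finite_subset _ _ fF).
      intros a Ha. rewrite in_diff in *. rewrite HA' in Ha. tauto.
Qed.

(** The union of infinitely many distinct sets is infinite, because they all belong to its power
    set. *)
Lemma infinite_cuf_of_quasi_dedekind : quasi_dedekind_infinite X ->
  exists A, subset A X /\ infinite A /\ cuf A.
Proof.
  intros (F & HF & w & f & Hw & Hf). apply is_omega_eq in Hw. subst w.
  destruct (injection_app _ _ _ Hf) as [fF I].
  assert (Df : dfun1 (app f)) by definability.
  set (C := image omega (app f)).
  assert (HC : forall B, B ∈ C -> subset B X /\ finite B).
  { intros B HB. apply in_image in HB; [|exact Df]. destruct HB as (n & Hn & ->).
    apply HF, fF, Hn. }
  exists (bigcup C). split; [|split].
  - intros y Hy. apply in_bigcup in Hy. destruct Hy as (B & HB & yB).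
    exact (proj1 (HC B HB) y yB).
  - intro fin. apply (infinite_of_injective C (app f) Df); [|exact I|].
    + intros n Hn. apply in_image; eauto.
    + apply (finite_subset _ _ (finite_power _ fin)). intros B HB. apply in_power.
      intros y Hy. apply in_bigcup. eauto.
  - exists C. split; [exact (countable_image _ _ Df countable_omega)|].
    split; [intros B HB; apply HC, HB|apply is_union_iff; reflexivity].
Qed.

Lemma contains_N_of_dedekind : dedekind_infinite X -> contains_alexandroff_of_N X T.
Proof.
  intros (w & f & Hw & Hf). apply is_omega_eq in Hw. subst w.
  destruct (injection_app _ _ _ Hf) as [fX I].
  apply (contains_N_of_sequence (app f)); [definability|exact fX|exact I].
Qed.

Lemma contains_N_of_well_orderable : infinite X -> well_orderable X ->
  contains_alexandroff_of_N X T.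
Proof.
  intros inf [R HR]. destruct (well_orders_omega X R HR inf) as (F & DF & FX & I).
  exact (contains_N_of_sequence F DF FX I).
Qed.

(** A dense set A cannot be finite: its complement would be a nonempty open set that misses A. *)
Lemma contains_N_of_separable : infinite X -> separable X T ->
  contains_alexandroff_of_N X T.
Proof.
  intros inf (A & AX & cA & dense). apply (contains_N_of_countable A AX); [|exact cA].
  intro fA. destruct (dense (diff X A)) as (a & aA & K).
  - apply open_remove_finite; [exact open_space|exact fA|exact AX].
  - apply set_nonempty. intro E. apply (infinite_diff X A inf fA).
    rewrite E. exact finite_empty.
  - apply in_diff in K. tauto.
Qed.

(** * Choice of points from closed sets under [BPI] *)

Lemma open_of_neighbourhoods U : subset U X ->
  (forall y, y ∈ U -> exists O, O ∈ T /\ y ∈ O /\ subset O U) -> U ∈ T.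
Proof.
  intros UX H. replace U with (bigcup (sep T (fun O => subset O U))).
  - apply open_bigcup. intros O HO. rewrite in_sep in HO by definability. tauto.
  - apply set_ext. intro y. rewrite in_bigcup. split.
    + intros (O & HO & Hy). rewrite in_sep in HO by definability. apply HO, Hy.
    + intro Hy. destruct (H y Hy) as (O & HO & yO & OU). exists O.
      rewrite in_sep by definability. auto.
Qed.

(** The chosen point of [K] is the limit of [s(K)] along an ultrafilter on the
    set of partial choice functions [s]. *)
Lemma closed_choice C : BPI V ->
  (forall K, K ∈ C -> subset K X /\ diff X K ∈ T /\ exists y, y ∈ K) ->
  exists c : V -> V, dfun1 c /\ forall K, K ∈ C -> c K ∈ K.
Proof.
  intros bpi HC.
  set (W := sep (power (product C X)) (fun s => (forall K y, rel s K y -> y ∈ K) /\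
    forall K y y', rel s K y -> rel s K y' -> y = y')).
  assert (HW : forall s, s ∈ W <-> s ∈ power (product C X) /\
    (forall K y, rel s K y -> y ∈ K) /\
    forall K y y', rel s K y -> rel s K y' -> y = y')
    by (intro; refine (in_sep _ _ _ _); definability).
  (* The partial choice functions defined on all of F. For finite F these sets form a filter base,
     since finitely many choices can always be made. *)
  set (dom := fun F => sep W (fun s => forall K, K ∈ F -> exists y, rel s K y)).
  assert (Hdom : forall F s, s ∈ dom F <-> s ∈ W /\
    forall K, K ∈ F -> exists y, rel s K y).
  { intros F s. apply (in_sep (fun s => forall K, K ∈ F -> exists y, rel s K y)).
    definability. }
  assert (Dd : dfun1 dom) by (unfold dom; definability).
  set (base := image (sep (power C) finite) dom).
  assert (Hbase : forall E, E ∈ base <-> exists F, (subset F C /\ finite F) /\ E = dom F).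
  { intro E. unfold base. rewrite in_image by exact Dd.
    assert (K : forall F, F ∈ sep (power C) finite <-> subset F C /\ finite F)
      by (intro; rewrite <- in_power; refine (in_sep _ _ _ _); definability).
    split; intros (F & HF & L); exists F; (split; [apply K, HF|exact L]). }
  assert (ne : forall F, finite F -> subset F C -> exists s, s ∈ dom F).
  { refine (finite_ind _ _ _ _); [definability| |].
    - intros _. exists empty. rewrite Hdom, HW, in_power.
      assert (N : forall K y, ~ rel empty K y)
        by (intros K y H; apply rel_iff in H; destruct (not_in_empty _ H)).
      split; [|intros K HK; destruct (not_in_empty _ HK)].
      split; [intros p Hp; destruct (not_in_empty _ Hp)|].
      split; [intros K y H|intros K y y' H]; destruct (N _ _ H).
    - intros F K0 _ _ IH H. destruct IH as [s Hs].
      { intros K HK. apply H, in_cup. auto. }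
      assert (HK0 : K0 ∈ C) by (apply H; rewrite in_cup, in_sing; auto).
      apply Hdom in Hs. destruct Hs as [sW sF]. apply HW in sW.
      destruct sW as (sP & s1 & s2).
      destruct (classic (exists y, rel s K0 y)) as [L|L].
      + exists s. rewrite Hdom, HW. split; [auto|]. intros K HK.
        rewrite in_cup, in_sing in HK. destruct HK as [HK| ->]; auto.
      + destruct (HC K0 HK0) as (KX & _ & y0 & Hy0).
        assert (R : forall K y, rel (cup s (sing (opair K0 y0))) K y <->
          rel s K y \/ (K = K0 /\ y = y0)).
        { intros K y. rewrite !rel_iff, in_cup, in_sing. split.
          - intros [M|M]; [auto|]. apply opair_inj in M. auto.
          - intros [M|[-> ->]]; auto. }
        exists (cup s (sing (opair K0 y0))). rewrite Hdom, HW. split; [split; [|split]|].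
        * rewrite in_power in *. intros p Hp. rewrite in_cup, in_sing in Hp.
          destruct Hp as [Hp| ->]; [auto|]. apply opair_in_product. auto.
        * intros K y M. apply R in M. destruct M as [M|[-> ->]]; eauto.
        * intros K y y' M M'. apply R in M, M'.
          destruct M as [M|[-> ->]], M' as [M'|[E ->]]; try subst K; eauto;
            destruct L; eauto.
        * intros K HK. rewrite in_cup, in_sing in HK.
          destruct HK as [HK| ->].
          -- destruct (sF K HK) as [y Hy]. exists y. apply R. auto.
          -- exists y0. apply R. auto. }
  destruct (ultrafilter_exists W base bpi) as (U & U1 & U2 & U3 & U4 & U5).
  - exists (dom empty). apply Hbase. exists empty.
    split; [split; [|exact finite_empty]|reflexivity].
    intros K HK. destruct (not_in_empty _ HK).
  - intros E HE s Hs. apply Hbase in HE. destruct HE as (F & _ & ->).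
    apply Hdom in Hs. tauto.
  - intros E HE. apply Hbase in HE. destruct HE as (F & [FC fF] & ->). auto.
  - intros E E' HE HE'. apply Hbase in HE, HE'.
    destruct HE as (F & [FC fF] & ->), HE' as (F' & [FC' fF'] & ->).
    exists (dom (cup F F')). split.
    + apply Hbase. exists (cup F F').
      split; [split; [|exact (finite_cup _ _ fF fF')]|reflexivity].
      intros K HK. apply in_cup in HK. destruct HK; auto.
    + intros s. rewrite in_cap, !Hdom. intros [sW H]. split; (split; [exact sW|]);
        intros K HK; apply H, in_cup; auto.
  (* The event that s(K) is defined and lies in O. Below, [lim K y] says that y is the limit of s(K)
     along the ultrafilter. *)
  - set (val := fun K O => sep W (fun s => exists y, y ∈ O /\ rel s K y)).
    assert (Hval : forall K O s, s ∈ val K O <-> s ∈ W /\ exists y, y ∈ O /\ rel s K y).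
    { intros K O s. apply (in_sep (fun s => exists y, y ∈ O /\ rel s K y)). definability. }
    assert (valW : forall K O, subset (val K O) W)
      by (intros K O s Hs; apply Hval in Hs; tauto).
    assert (Dv : dfun2 val) by (unfold val; definability).
    assert (val_empty : forall A, A ∈ U -> (forall s, s ∉ A) -> False).
    { intros A HA N. apply U2. replace empty with A; [exact HA|].
      apply is_empty_iff. exact N. }
    set (lim := fun K y => forall O, O ∈ T -> y ∈ O -> val K O ∈ U).
    assert (Dl : definable2 lim) by (unfold lim; definability).
    assert (ex : forall K, K ∈ C -> exists y, y ∈ X /\ lim K y).
    { intros K HK. apply NNPP. intro N.
      set (bad := sep T (fun O => val K O ∉ U)).
      assert (Hbad : forall O, O ∈ bad <-> O ∈ T /\ val K O ∉ U)
        by (intro; refine (in_sep _ _ _ _); definability).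
      destruct (comp bad) as (F & Fb & fF & cF).
      - intros O HO. apply Hbad in HO. tauto.
      - intros y Hy. apply NNPP. intro M. apply N. exists y. split; [exact Hy|].
        intros O HO yO. apply NNPP. intro L. apply M. exists O.
        rewrite Hbad. auto.
      (* Without a limit, finitely many open sets with events outside [U] cover X. By primeness the
         event of their union is outside [U] too, although it contains [dom (sing K)]. *)
      - assert (small : forall F, finite F -> subset F bad -> val K (bigcup F) ∉ U).
        { refine (finite_ind _ _ _ _); [definability| |].
          - intros _ L. apply (val_empty _ L). intros s Hs. apply Hval in Hs.
            destruct Hs as (_ & y & Hy & _). apply in_bigcup in Hy.
            destruct Hy as (O & HO & _). destruct (not_in_empty _ HO).
          - intros G O _ _ IH HG L.
            destruct (U5 (val K (bigcup G)) (val K O)) as [M|M]; auto.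
            + apply (U3 _ _ L).
              * intros s Hs. apply Hval in Hs. destruct Hs as (sW & y & Hy & R).
                apply in_bigcup in Hy. destruct Hy as (O' & HO' & Hy).
                rewrite in_cup, in_sing in HO'. rewrite in_cup, !Hval.
                destruct HO' as [HO'| ->]; [left|right]; (split; [exact sW|]);
                  exists y; rewrite ?in_bigcup; eauto.
              * intros s Hs. apply in_cup in Hs. destruct Hs as [Hs|Hs]; exact (valW _ _ s Hs).
            + revert M. apply IH. intros O' HO'. apply HG, in_cup. auto.
            + revert M. apply Hbad, HG. rewrite in_cup, in_sing. auto. }
        apply (small F fF Fb). apply (U3 (dom (sing K))); [|intros s Hs|apply valW].
        + apply U1, Hbase. exists (sing K).
          split; [split; [|apply finite_sing]|reflexivity].
          intros K' HK'. apply in_sing in HK'. subst. exact HK.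
        + apply Hdom in Hs. destruct Hs as [sW L]. apply Hval. split; [exact sW|].
          destruct (L K) as [y R]; [apply in_sing; reflexivity|]. exists y.
          split; [|exact R]. apply HW in sW. apply in_bigcup, cF, (HC K HK).
          apply sW in R. exact R. }
    assert (uniq : forall K y y', y ∈ X -> y' ∈ X -> lim K y -> lim K y' -> y = y').
    { intros K y y' Hy Hy' L L'. apply NNPP. intro Hne.
      destruct (haus y y' Hy Hy' Hne) as (O & O' & HO & HO' & yO & yO' & N).
      apply (val_empty _ (U4 _ _ (L O HO yO) (L' O' HO' yO'))). intros s Hs.
      rewrite in_cap, !Hval in Hs.
      destruct Hs as [(sW & z & Hz & R) (_ & z' & Hz' & R')].
      apply HW in sW. destruct sW as (_ & _ & F).
      apply N. exists z. split; [exact Hz|]. rewrite (F _ _ _ R R'). exact Hz'. }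
    exists (fun K => the_in X (lim K)). split; [definability|]. intros K HK.
    destruct (the_in_spec (lim K) X) as [H L]; [definability| |].
    + destruct (ex K HK) as (y & Hy & L). exists y. split; [auto|].
      intros z [Hz M]. exact (uniq K y z Hy Hz L M).
    (* If the limit were outside K, the event that s(K) lies in the open complement of K would
       belong to [U]; but this event is empty. *)
    + apply NNPP. intro N. destruct (HC K HK) as (KX & oK & _).
      apply (val_empty (val K (diff X K))).
      * apply L; [exact oK|]. apply in_diff. auto.
      * intros s Hs. apply Hval in Hs. destruct Hs as (sW & y & Hy & R).
        apply in_diff in Hy. apply (proj2 Hy). apply HW in sW. apply sW in R. exact R.
Qed.

(** Hausdorff separations are combined one point at a time, by intersecting the neighbourhoods of x
    and uniting the others. *)
Lemma separate_finite x F : x ∈ X -> finite F -> subset F X -> x ∉ F ->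
  exists N O, N ∈ T /\ O ∈ T /\ x ∈ N /\ subset F O /\ ~ exists z, z ∈ N /\ z ∈ O.
Proof.
  intros Hx. revert F. refine (finite_ind _ _ _ _); [definability| |].
  - intros _ _. exists X, empty. split; [exact open_space|]. split; [exact open_empty|].
    split; [exact Hx|]. split; [intros y Hy; exact Hy|].
    intros (z & _ & Hz). exact (not_in_empty _ Hz).
  - intros F a _ _ IH FX xF. rewrite in_cup, in_sing in xF.
    destruct IH as (N & O & HN & HO & xN & FO & dis).
    { intros y Hy. apply FX, in_cup. auto. }
    { tauto. }
    assert (aX : a ∈ X) by (apply FX; rewrite in_cup, in_sing; auto).
    destruct (haus x a Hx aX) as (N' & O' & HN' & HO' & xN' & aO' & dis'); [tauto|].
    exists (cap N N'), (bigcup (upair O O')).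
    split; [apply open_cap; assumption|]. split.
    { apply open_bigcup. intros Q HQ. apply in_upair in HQ. destruct HQ; subst; assumption. }
    split; [apply in_cap; auto|]. split.
    + intros y Hy. rewrite in_cup, in_sing in Hy. apply in_bigcup.
      destruct Hy as [Hy| ->]; [exists O|exists O']; rewrite in_upair; auto.
    + intros (z & Hz & Hz'). apply in_cap in Hz. apply in_bigcup in Hz'.
      destruct Hz' as (Q & HQ & zQ). apply in_upair in HQ.
      destruct HQ; subst Q; [apply dis|apply dis']; exists z; tauto.
Qed.

Lemma contains_N_of_BPI : BPI V -> infinite X -> contains_alexandroff_of_N X T.
Proof.
  intros bpi inf.
  destruct (accumulation_point X comp (fun y Hy => Hy) inf) as (x & Hx & acc).
  destruct (decreasing_base x fc Hx) as (B & DB & B1 & B2 & B3).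
  (* [H n m] is the part outside [B m] of the closure of [B n]. *)
  set (H := fun n m => sep X (fun y => y ∉ B m /\
    forall O, O ∈ T -> y ∈ O -> exists z, z ∈ O /\ z ∈ B n)).
  assert (DH : dfun2 H) by (unfold H; definability).
  assert (HH : forall n m y, y ∈ H n m <-> y ∈ X /\ y ∉ B m /\
    forall O, O ∈ T -> y ∈ O -> exists z, z ∈ O /\ z ∈ B n).
  { intros n m y. apply (in_sep (fun y => y ∉ B m /\
      forall O, O ∈ T -> y ∈ O -> exists z, z ∈ O /\ z ∈ B n)). definability. }
  set (M := fun n => sep omega (fun m => exists y, y ∈ H n m)).
  assert (DM : dfun1 M) by (unfold M; definability).
  assert (HM : forall n m, m ∈ M n <-> m ∈ omega /\ exists y, y ∈ H n m)
    by (intros n m; apply (in_sep (fun m => exists y, y ∈ H n m)); definability).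
  (* Taking the least m for which [H n m] is nonempty makes the family definable without any
     choice. *)
  set (K := fun n => H n (least (M n))).
  assert (DK : dfun1 K) by (unfold K; definability).
  assert (HK : forall n, n ∈ omega -> least (M n) ∈ M n).
  { intros n Hn. apply least_spec; [intros m Hm; apply HM in Hm; tauto|].
    destruct (B1 n Hn) as [On xn].
    destruct (infinite_other _ x (acc (B n) On xn)) as (y & Hy & yx).
    apply in_cap in Hy. destruct Hy as [Hy yn].
    destruct (B3 (diff X (sing y))) as (m & Hm & L).
    - apply open_remove_point, Hy.
    - rewrite in_diff, in_sing. auto.
    - exists m. apply HM. split; [exact Hm|]. exists y. apply HH.
      split; [exact Hy|]. split.
      + intro ym. specialize (L y ym). rewrite in_diff, in_sing in L. tauto.
      + intros O _ yO. eauto. }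
  destruct (closed_choice (image omega K) bpi) as (c & Dc & Hc).
  - intros F HF. apply in_image in HF; [|exact DK]. destruct HF as (n & Hn & ->).
    pose proof (HK n Hn) as L. apply HM in L. destruct L as [Lm Ly].
    split; [intros y Hy; apply HH in Hy; tauto|]. split; [|exact Ly].
    apply open_of_neighbourhoods; [intros y Hy; apply in_diff in Hy; tauto|].
    intros y Hy. apply in_diff in Hy. destruct Hy as [Hy N].
    destruct (B1 _ Lm) as [Om _].
    (* [K n] is closed: a point outside it has either [B m] itself, for that least m, or an open set
       disjoint from [B n] as a neighbourhood that misses [K n]. *)
    destruct (classic (y ∈ B (least (M n)))) as [L|L].
    + exists (B (least (M n))). split; [exact Om|]. split; [exact L|]. intros z Hz.
      apply in_diff. split; [exact (open_subset _ Om z Hz)|].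
      unfold K. rewrite HH. tauto.
    + apply NNPP. intro Q. apply N. apply HH. split; [exact Hy|]. split; [exact L|].
      intros O HO yO. apply NNPP. intro R. apply Q. exists O.
      split; [exact HO|]. split; [exact yO|]. intros z Hz. apply in_diff.
      split; [exact (open_subset O HO z Hz)|]. intro Kz. apply HH in Kz.
      destruct Kz as (_ & _ & Kz). exact (R (Kz O HO Hz)).
  - assert (Df : dfun1 (fun n => c (K n))) by definability.
    assert (cK : forall n, n ∈ omega -> c (K n) ∈ K n).
    { intros n Hn. apply Hc, in_image; eauto. }
    assert (sub : subset (image omega (fun n => c (K n))) X).
    { intros y Hy. apply in_image in Hy; [|exact Df]. destruct Hy as (n & Hn & ->).
      pose proof (cK n Hn) as L. apply HH in L. tauto. }
    apply (contains_N_of_countable _ sub);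
      [|exact (countable_image _ _ Df countable_omega)].
    (* If the chosen points were finitely many, disjoint open sets would separate x from all of
       them. For [B n] inside the neighbourhood of x, the point chosen for n lies in the closure of
       [B n], so the other open set meets [B n], a contradiction. *)
    intro fin. destruct (separate_finite x _ Hx fin sub) as (N & O & HN & HO & xN & FO & dis).
    (* No chosen point equals x, since each lies outside some [B m] while x belongs to every one of
       them. *)
    + intro xA. apply in_image in xA; [|exact Df]. destruct xA as (n & Hn & E).
      pose proof (cK n Hn) as L. rewrite <- E in L. apply HH in L.
      destruct L as (_ & L & _). apply L. pose proof (HK n Hn) as Q. apply HM in Q.
      apply B1, Q.
    + destruct (B3 N HN xN) as (n & Hn & BN).
      pose proof (cK n Hn) as L. apply HH in L. destruct L as (_ & _ & L).
      destruct (L O HO) as (z & zO & zB).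
      * apply FO, in_image; eauto.
      * apply dis. exists z. auto.
Qed.

End CompactSpace.

End ZFModel.

(** * Copies of one-point compactifications under each principle and hypothesis *)

Theorem theorem5p2 (V : structure) (hZF : ZF V) :
  (IQDI V ->
     forall X T : V, topology X T ->
       infinite X -> compact X T -> first_countable X T -> hausdorff X T ->
       contains_alexandroff_of_infinite_discrete_cuf X T)
  /\
  ((IDI V \/ WoAm V \/ BPI V) ->
     forall X T : V, topology X T ->
       infinite X -> compact X T -> first_countable X T -> hausdorff X T ->
       contains_alexandroff_of_N X T)
  /\
  ((forall X T : V, topology X T ->
      infinite X -> first_countable X T -> compact X T -> hausdorff X T ->
      separable X T ->
      contains_alexandroff_of_N X T)
   /\
   (forall X T : V, topology X T ->
      infinite X -> first_countable X T -> compact X T -> hausdorff X T ->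
      (exists A : V, subset A X /\ infinite A /\ cuf A) ->
      contains_alexandroff_of_infinite_discrete_cuf X T)).
Proof.
  split; [|split; [|split]].
  - intros iqdi X T top inf comp fc haus.
    destruct (infinite_cuf_of_quasi_dedekind hZF X (iqdi X inf)) as (A & AX & HA).
    apply (contains_cuf_of_infinite_cuf hZF X T top haus comp fc A AX); apply HA.
  - intros H X T top inf comp fc haus. destruct H as [idi|[woam|bpi]].
    + apply (contains_N_of_dedekind hZF X T top haus comp fc), idi, inf.
    + destruct (woam X inf) as [wo|(A & AX & am)].
      * exact (contains_N_of_well_orderable hZF X T top haus comp fc inf wo).
      * destruct (no_amorphous_subset hZF X T top haus comp fc A AX am).
    + exact (contains_N_of_BPI hZF X T top haus comp fc bpi inf).
  - intros X T top inf fc comp haus sep.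
    exact (contains_N_of_separable hZF X T top haus comp fc inf sep).
  - intros X T top inf fc comp haus (A & AX & HA).
    apply (contains_cuf_of_infinite_cuf hZF X T top haus comp fc A AX); apply HA.
Qed.
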